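(* Let $n\ge1$. For every Hessenberg function $\mathbf m\colon[n]\to[n]$, \[ \mathrm{csf}_q(G_{\mathbf m};x,q)=\sum_{k=0}^{n-1}[n-k]_q\,e_{n-k}\,g_k(\mathbf m;x,q). \]
   Context: $[n]=\{1,\dots,n\}$. A Hessenberg function is a non-decreasing $\mathbf m\colon[n]\to[n]$ with $\mathbf m(i)\ge i$ for all $i$. $G_{\mathbf m}$ is the graph with vertex set $[n]$ and edges $\{i,j\}$ for $i<j\le\mathbf m(i)$. Its chromatic quasisymmetric function (which is symmetric) is $\mathrm{csf}_q(G_{\mathbf m};x,q)=\sum_\kappa q^{\mathrm{asc}(\kappa)}\prod_{j\in[n]}x_{\kappa(j)}$, the sum over all proper colorings $\kappa\colon[n]\to\mathbb{N}$ of $G_{\mathbf m}$, where $\mathrm{asc}(\kappa)=|\{(i,j): i<j\le\mathbf m(i),\ \kappa(i)<\kappa(j)\}|$. $h_j,e_j$ are the complete homogeneous and elementary symmetric functions ($h_0=e_0=1$), and $\omega$ is the $q$-linear involution with $\omega(h_j)=e_j$. With $[n]_q=1+q+\dots+q^{n-1}$, $\rho_n$ ($n\ge1$) is defined recursively by $[n]_qh_n=\sum_{i=0}^{n-1}h_i\rho_{n-i}$. $S_{n,\mathbf m}=\{\sigma\in S_n:\sigma(i)\le\mathbf m(i)\text{ for all }i\}$. Each $\sigma\in S_n$ is written as its cycle decomposition $\sigma=\tau_1\cdots\tau_j$ (fixed points included), each cycle beginning with its smallest element and cycles ordered increasingly by their smallest elements; $|\tau_i|$ is the length of $\tau_i$.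 $\sigma^c$ is the permutation whose one-line notation is obtained by erasing the parentheses (e.g. $\sigma=(154)(2639)(78)$ gives $\sigma^c=154263978$). $\mathrm{wt}_{\mathbf m}(\sigma)$ is the number of pairs $(i,j)$ with $i<j\le\mathbf m(i)$ and $(\sigma^c)^{-1}(i)>(\sigma^c)^{-1}(j)$. For $k<n$, \[ g_k(\mathbf m;x,q):=\sum_{\substack{\sigma=\tau_1\cdots \tau_{j}\in S_{n,\mathbf m}\\ |\tau_1|\geq n-k}} (-1)^{|\tau_1|-n+k}q^{\mathrm{wt}_{\mathbf m}(\sigma)}h_{|\tau_1|-n+k}\,\omega(\rho_{|\tau_2|}\cdots \rho_{|\tau_j|}). \] *)

(* Defs.v *)
From HB Require Import structures.
From mathcomp Require Import all_boot all_order all_algebra all_fingroup.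
From mathcomp Require Import finmap.
From mathcomp Require Import boolp classical_sets functions cardinality fsbigop.
From mathcomp.multinomials Require mpoly.
From mathcomp.multinomials Require Import monalg.

Set Implicit Arguments.
Unset Strict Implicit.
Unset Printing Implicit Defensive.

Import GRing.Theory.

Local Open Scope classical_set_scope.
Local Open Scope ring_scope.

Notation "1" := (@mone _) : monom_scope.
Notation "u * v" := (mmul u v) : monom_scope.

(* Monomials in the variables x_0, x_1, x_2, ... *)
Notation mon := {cmonom nat}.

(* Formal power series in infinitely many variables: f u is the coefficient of
   the monomial u. *)
Record series (R : Type) := Series { scoef :> mon -> R }.

Definition splits (u : mon) : set (mon * mon) :=
  [set p | (p.1 * p.2)%M = u].

Lemma finite_splits u : finite_set (splits u).
Proof.
pose T := {ffun finsupp u -> 'I_(mdeg u).+1}.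
pose mk (f : T) : mon := [cmonom nat_of_ord (f i) | i : finsupp u]%M.
have mdeg_ge (v : mon) i : (v i <= mdeg v)%N.
  case: (boolP (i \in finsupp v)) => [iv|]; last by rewrite -cmE_eq0 => /eqP->.
  by rewrite mdegE (big_fsetD1 i) //= leq_addr.
have mkP (v w : mon) : (v * w)%M = u -> exists f, mk f = v.
  move=> vw; exists [ffun i => inord (v (val i))]; apply/eqP/cmP => i.
  rewrite /mk cmE /= fsfun_ffun; case: insubP => [j ij ji|iu] /=.
    rewrite ffunE inordK ?ji // ltnS -vw mdegM.
    by rewrite (leq_trans (mdeg_ge v _)) ?leq_addr.
  by move: iu; rewrite -cmE_eq0 -vw cmM addn_eq0 => /andP[/eqP->].
apply: (@sub_finite_set _ _ ((fun q : T * T => (mk q.1, mk q.2)) @` setT)).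
  move=> [v w]; rewrite /splits /= => vw; have [f <-] := mkP _ _ vw.
  by have [|g <-] := mkP w v; [rewrite mulmC|exists (f, g)].
exact/finite_image/finite_finset.
Qed.

Section Series.
Variable R : comNzRingType.
Implicit Types f g h : series R.

Lemma seriesP f g : f =1 g <-> f = g.
Proof. by case: f g => [f] [g]; split=> [/= /funext->|[->]]. Qed.

HB.instance Definition _ := gen_eqMixin (series R).
HB.instance Definition _ := gen_choiceMixin (series R).

Definition addS f g := Series (fun u => f u + g u).
Definition oppS f := Series (fun u => - f u).
Definition zeroS : series R := Series (fun=> 0).
Definition oneS : series R := Series (fun u => (u == 1%M)%:R).
Definition scaleS (c : R) f := Series (fun u => c * f u).
Definition mulS f g :=
  Series (fun u => \sum_(p \in splits u) f p.1 * g p.2).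

Fact addSA : associative addS.
Proof. by move=> f g h; apply/seriesP => u /=; rewrite addrA. Qed.
Fact addSC : commutative addS.
Proof. by move=> f g; apply/seriesP => u /=; rewrite addrC. Qed.
Fact add0S : left_id zeroS addS.
Proof. by move=> f; apply/seriesP => u /=; rewrite add0r. Qed.
Fact addNS : left_inverse zeroS oppS addS.
Proof. by move=> f; apply/seriesP => u /=; rewrite addNr. Qed.
HB.instance Definition _ :=
  GRing.isZmodule.Build (series R) addSA addSC add0S addNS.

Definition splitl u : seq (mon * mon) := fset_set (splits u).

Lemma mem_splitl u p : (p \in splitl u) = ((p.1 * p.2)%M == u).
Proof.
rewrite /splitl in_fset_set; last exact: finite_splits.
by apply/idP/eqP; rewrite inE.
Qed.

Lemma mulSE f g u : mulS f g u = \sum_(p <- splitl u) f p.1 * g p.2.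
Proof. by rewrite /= fsbig_finite //; apply: finite_splits. Qed.

Fact mulSA : associative mulS.
Proof.
move=> f g h; apply/seriesP => u; rewrite !mulSE.
under eq_bigr do rewrite mulSE mulr_sumr.
under [RHS]eq_bigr do rewrite mulSE mulr_suml.
pose F (t : mon * mon * mon) := f t.1.1 * g t.1.2 * h t.2.
transitivity (\sum_(t <- [seq (p.1, q.1, q.2) | p <- splitl u, q <- splitl p.2])
   F t).
  rewrite big_allpairs_dep; apply: eq_bigr => p _; apply: eq_bigr => q _.
  by rewrite /F /= mulrA.
rewrite [RHS](_ : _ =
  \sum_(t <- [seq (q.1, q.2, p.2) | p <- splitl u, q <- splitl p.1]) F t).
  apply: perm_big; apply: uniq_perm.
  - apply: allpairs_uniq_dep => [|p _|]; try exact: fset_uniq.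
    move=> x y /allpairsPdep[[p1 p2] [[q1 q2] [_ qp ->]]].
    case/allpairsPdep=> [[p1' p2'] [[q1' q2'] [_ qp' ->]]] [e1 e2 e3].
    move: qp qp'; rewrite !mem_splitl /= => /eqP<- /eqP<-.
    by rewrite e1 e2 e3.
  - apply: allpairs_uniq_dep => [|p _|]; try exact: fset_uniq.
    move=> x y /allpairsPdep[[p1 p2] [[q1 q2] [_ qp ->]]].
    case/allpairsPdep=> [[p1' p2'] [[q1' q2'] [_ qp' ->]]] [e1 e2 e3].
    move: qp qp'; rewrite !mem_splitl /= => /eqP<- /eqP<-.
    by rewrite e1 e2 e3.
  - move=> [[a b] c]; apply/allpairsPdep/allpairsPdep => -[[p1 p2] [[q1 q2] []]];
      rewrite !mem_splitl /= => /eqP pu /eqP qp [-> -> ->].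
      exists ((p1 * q1)%M, q2), (p1, q1).
      by rewrite !mem_splitl /= -mulmA qp pu !eqxx.
    exists (q1, (q2 * p2)%M), (q2, p2).
    by rewrite !mem_splitl /= mulmA qp pu !eqxx.
by rewrite big_allpairs_dep.
Qed.


Fact mulSC : commutative mulS.
Proof.
move=> f g; apply/seriesP => u; rewrite !mulSE.
pose sw (p : mon * mon) := (p.2, p.1).
have swK : cancel sw sw by case.
rewrite [RHS](_ : _ = \sum_(p <- map sw (splitl u)) f p.1 * g p.2).
  apply: perm_big; apply: uniq_perm; rewrite ?(map_inj_uniq (can_inj swK)) //.
  - exact: fset_uniq.
  - exact: fset_uniq.
  - by move=> p; rewrite -{2}[p]swK (mem_map (can_inj swK)) !mem_splitl /= mulmC.
by rewrite big_map; apply: eq_bigr => p _ /=; rewrite mulrC.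
Qed.

Fact mul1S : left_id oneS mulS.
Proof.
move=> f; apply/seriesP => u; rewrite mulSE.
rewrite (bigD1_seq (1%M, u)) ?mem_splitl ?mul1m ?fset_uniq //= eqxx mul1r.
rewrite big_seq_cond big1 ?addr0 // => -[v w] /andP[].
rewrite mem_splitl /= => /eqP vw; have [v1|_ _] := eqVneq v 1%M; last by rewrite mul0r.
by rewrite -vw v1 mul1m eqxx.
Qed.

Fact mulSDl : left_distributive mulS addS.
Proof.
move=> f g h; apply/seriesP => u; change (mulS (addS f g) h u = mulS f h u + mulS g h u).
by rewrite !mulSE -big_split; apply: eq_bigr => p _ /=; rewrite mulrDl.
Qed.

Fact oneS_neq0 : oneS != zeroS.
Proof.
apply/eqP => /seriesP/(_ 1%M) /= /eqP; rewrite eqxx; exact/negP/oner_neq0.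
Qed.
HB.instance Definition _ := GRing.Zmodule_isComNzRing.Build (series R)
  mulSA mulSC mul1S mulSDl oneS_neq0.

Fact scaleSA a b f : scaleS a (scaleS b f) = scaleS (a * b) f.
Proof. by apply/seriesP => u /=; rewrite mulrA. Qed.
Fact scale1S : left_id 1 scaleS.
Proof. by move=> f; apply/seriesP => u /=; rewrite mul1r. Qed.
Fact scaleSDr : right_distributive scaleS +%R.
Proof. by move=> a f g; apply/seriesP => u /=; rewrite mulrDr. Qed.
Fact scaleSDl f : {morph scaleS^~ f : a b / a + b}.
Proof. by move=> a b; apply/seriesP => u /=; rewrite mulrDl. Qed.
HB.instance Definition _ := GRing.Zmodule_isLmodule.Build R (series R)
  scaleSA scale1S scaleSDr scaleSDl.

Fact scaleSAl a f g : a *: (f * g) = (a *: f) * g.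
Proof.
apply/seriesP => u; change (a * mulS f g u = mulS (scaleS a f) g u).
by rewrite !mulSE mulr_sumr; apply: eq_bigr => p _ /=; rewrite mulrA.
Qed.
HB.instance Definition _ := GRing.Lmodule_isLalgebra.Build R (series R) scaleSAl.
HB.instance Definition _ := GRing.Lalgebra_isComAlgebra.Build R (series R).
End Series.

Section SymmetricFunctions.
Variable R : comNzRingType.

(* v is obtained from u by permuting the variables. *)
Definition permutation_invariant (f : series R) :=
  forall (s : nat -> nat) (u v : mon),
    bijective s -> (forall i, v i = u (s i)) -> f v = f u.

Definition bounded_degree (f : series R) :=
  exists d, forall u : mon, (d < mdeg u)%N -> f u = 0.

Definition symseries : {pred series R} :=
  fun f => `[< permutation_invariant f /\ bounded_degree f >].

Lemma symseriesP f :
  reflect (permutation_invariant f /\ bounded_degree f) (f \in symseries).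
Proof. exact: asboolP. Qed.

Lemma mon_permute (s : nat -> nat) : bijective s ->
  exists2 P : mon -> mon, bijective P & forall u i, P u i = u (s i).
Proof.
have mk (r r' : nat -> nat) : cancel r r' -> cancel r' r ->
    {P : mon -> mon | forall u i, P u i = u (r i)}.
  move=> rK r'K; exists (fun u => [cmonom u (r i) | i in r' @` finsupp u]%M).
  move=> u i; rewrite cmE /= fsfun_fun; case: ifP => // /negP iu.
  apply/esym/eqP; rewrite cmE_eq0; apply/negP => riu; apply: iu.
  by apply/imfsetP; exists (r i).
case=> t sK tK; have [P PE] := mk s t sK tK; have [Q QE] := mk t s tK sK.
exists P => //; exists Q => u; apply/eqP/cmP => i.
  by rewrite QE PE tK.
by rewrite PE QE sK.
Qed.

Lemma mdeg_permute (s : nat -> nat) (u v : mon) : bijective s ->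
  (forall i, v i = u (s i)) -> mdeg v = mdeg u.
Proof.
move=> [t sK tK] vu; rewrite (@mdegEw _ u (s @` finsupp v)%fset).
  rewrite mdegE big_imfset /=; last by move=> i j _ _ /(can_inj sK).
  by apply: eq_bigr => i _.
apply/fsubsetP => i; rewrite -cmE_neq0 => ui; apply/imfsetP; exists (t i).
  by rewrite /= -cmE_neq0 vu tK.
by rewrite tK.
Qed.

Fact symseries_subalg : subalg_closed symseries.
Proof.
split=> [|a f g /symseriesP[fs [d fd]] /symseriesP[gs [e ge]]
  |f g /symseriesP[fs [d fd]] /symseriesP[gs [e ge]]]; apply/symseriesP; split.
- move=> s u v sb vu /=; rewrite -!mdeg_eq0.
  by rewrite (mdeg_permute sb vu).
- by exists 0 => u; rewrite lt0n mdeg_eq0 /= => /negPf->.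
- by move=> s u v sb vu; rewrite /= (fs s u v) ?(gs s u v).
- exists (maxn d e) => u; rewrite gtn_max /= => /andP[du eu].
  by rewrite fd ?ge // mulr0 addr0.
- move=> s u v sb vu; change (mulS f g v = mulS f g u); rewrite !mulSE.
  have [P Pb PE] := mon_permute sb.
  have PM : {morph P : x y / (x * y)%M}.
    by move=> x y; apply/eqP/cmP => i; rewrite cmM !PE cmM.
  have -> : v = P u by apply/eqP/cmP => i; rewrite PE.
  rewrite (perm_big (map (fun p => (P p.1, P p.2)) (splitl u))) /=.
    by rewrite big_map; apply: eq_bigr => p _ /=; congr (_ * _);
      [apply: (fs s)|apply: (gs s)].
  have PPi : injective (fun p : mon * mon => (P p.1, P p.2)).
    by case=> a b [c d'] [] /(bij_inj Pb)-> /(bij_inj Pb)->.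
  apply: uniq_perm; rewrite ?(map_inj_uniq PPi) ?fset_uniq //.
  move=> [x y]; have [Q QK KQ] := Pb.
  have Ei := mem_map PPi (splitl u) (Q x, Q y); rewrite /= !KQ in Ei.
  by rewrite Ei !mem_splitl /= -[RHS](inj_eq (bij_inj Pb)) PM !KQ.
- exists (d + e)%N => u du; change (mulS f g u = 0); rewrite mulSE.
  rewrite big_seq big1 // => -[x y]; rewrite mem_splitl /= => /eqP xy.
  have [dx|xd] := ltnP d (mdeg x); first by rewrite fd ?mul0r.
  rewrite ge ?mulr0 // ltnNge; apply/negP => ye.
  by move: du; rewrite -xy mdegM ltnNge leq_add.
Qed.
HB.instance Definition _ :=
  GRing.isSubalgClosed.Build R (series R) symseries symseries_subalg.

Record symfun := SymFun { sf_series :> series R; _ : sf_series \in symseries }.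
HB.instance Definition _ := [isSub for sf_series].
HB.instance Definition _ := [Choice of symfun by <:].
HB.instance Definition _ := [SubChoice_isSubAlgebra of symfun by <:].
HB.instance Definition _ := [SubNzRing_isSubComNzRing of symfun by <:].

Fact complete_sym (j : nat) :
  Series (fun u => (mdeg u == j)%:R) \in symseries.
Proof.
apply/symseriesP; split=> [s u v sb vu /=|]; first by rewrite (mdeg_permute sb vu).
by exists j => u /gtn_eqF /= ->.
Qed.
Definition h_ j : symfun := SymFun (complete_sym j).

Fact elementary_sym (j : nat) :
  Series (fun u => ((mdeg u == j) && all (fun i => u i == 1%N) (finsupp u))%:R)
    \in symseries.
Proof.
apply/symseriesP; split=> [s u v sb vu /=|]; last first.
  by exists j => u /gtn_eqF /= ->.
rewrite (mdeg_permute sb vu); congr (_ && _)%:R; have [t sK tK] := sb.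
apply/allP/allP => uP i iu.
  by rewrite -[i]tK -vu uP // -cmE_neq0 vu tK cmE_neq0.
by rewrite vu uP // -cmE_neq0 -vu cmE_neq0.
Qed.
Definition e_ j : symfun := SymFun (elementary_sym j).

End SymmetricFunctions.

Lemma h_0 (R : comNzRingType) : h_ R 0 = 1.
Proof. by apply/val_inj/seriesP => u /=; rewrite mdeg_eq0. Qed.

Lemma e_0 (R : comNzRingType) : e_ R 0 = 1.
Proof.
apply/val_inj/seriesP => u /=; rewrite mdeg_eq0.
case: eqP => // ->; congr _%:R; rewrite (_ : all _ _ = true) //.
by apply/allP => i; rewrite mdom1.
Qed.

(* Existence of omega. Every symmetric function is a polynomial in the e_j, unique
   up to enlarging the set of variables (ev_e_surj, ev_e_inj); this reduces to the
   fundamental theorem on symmetric polynomials in N variables by truncation.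
   Substituting h_j for e_j gives an algebra morphism that sends e_j to h_j, and it
   sends h_j to e_j because of the relation sum_e_h. *)
Section OmegaExistence.
Import mpoly.

Local Notation Z_q := {poly int}.
Local Notation MP N := (mpoly.mpoly N Z_q).
Local Notation Lambda := (symfun Z_q).
Local Notation S N := [tuple mesym N Z_q i.+1 | i < N].

Definition low N : {fset nat} := [fset i in iota 0 N]%fset.
Lemma mem_low N i : (i \in low N) = (i < N)%N.
Proof. by rewrite !inE mem_iota. Qed.

Section Truncation.
Variable N : nat.

Definition mon_ext (a : 'X_{1..N}) : mon :=
  [cmonom (if insub i is Some j then a j else 0) | i in low N]%M.

Lemma mon_extE a (j : 'I_N) : mon_ext a j = a j.
Proof.
by rewrite /mon_ext cmE fsfun_fun mem_low ltn_ord valK.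
Qed.

Lemma mon_extO a i : (N <= i)%N -> mon_ext a i = 0%N.
Proof. by move=> Ni; rewrite /mon_ext cmE fsfun_fun mem_low ltnNge Ni. Qed.

Lemma monP (u v : mon) : (forall j : 'I_N, u j = v j) ->
  (forall i, (N <= i)%N -> u i = v i) -> u = v.
Proof.
move=> lo hi; apply/eqP/cmP => i; have [iN|/hi//] := ltnP i N.
exact: (lo (Ordinal iN)).
Qed.

Lemma mon_extD a b : mon_ext (a + b) = (mon_ext a * mon_ext b)%M.
Proof.
apply: monP => [j|i Ni]; rewrite cmM; first by rewrite !mon_extE mnmDE.
by rewrite !mon_extO.
Qed.

Lemma mdeg_mon_ext a : monalg.mdeg (mon_ext a) = mdeg a.
Proof.
rewrite (@mdegEw _ _ (low N)); last first.
  apply/fsubsetP => i; rewrite -cmE_neq0 mem_low.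
  by apply: contraR; rewrite -leqNgt => /mon_extO->.
rewrite mpoly.mdegE (perm_big (iota 0 N)) /=; last first.
  by apply: uniq_perm; rewrite ?fset_uniq ?iota_uniq // => i; rewrite mem_low mem_iota.
rewrite -[X in iota _ X]subn0 big_mkord.
by apply: eq_bigr => i _; rewrite mon_extE.
Qed.

Definition mon_restr (u : mon) : 'X_{1..N} := [multinom u i | i < N].

Lemma mon_extK : cancel mon_ext mon_restr.
Proof. by move=> a; apply/mnmP => i; rewrite mnmE mon_extE. Qed.

Lemma mon_restrK (u : mon) : (forall i, (N <= i)%N -> u i = 0%N) ->
  mon_ext (mon_restr u) = u.
Proof.
move=> u0; apply: monP => [j|i Ni]; first by rewrite mon_extE mnmE.
by rewrite mon_extO ?u0.
Qed.

Lemma symfun_bounded (f : Lambda) :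
  {d | forall u : mon, (d < monalg.mdeg u)%N -> f u = 0}.
Proof. by apply: cid; case: f => f /= /symseriesP[]. Qed.

Definition trunc (f : Lambda) : MP N :=
  \sum_(a : 'X_{1..N < (projT1 (symfun_bounded f)).+1}) f (mon_ext a) *: 'X_[a].

Lemma truncE f a : (trunc f)@_a = f (mon_ext a).
Proof.
rewrite /trunc; case: symfun_bounded => d fd /=.
have [da|] := boolP (mdeg a < d.+1)%N; first exact: (mcoeff_mpoly (fun b => f (mon_ext b))).
rewrite -leqNgt => da; rewrite fd ?mdeg_mon_ext // raddf_sum big1 // => -[b bd] _ /=.
rewrite mcoeffZ mcoeffX; case: eqP => [ba|]; last by rewrite mulr0.
by move: bd; rewrite ba ltnNge da.
Qed.

Fact trunc_is_linear : linear trunc.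
Proof. by move=> c f g; apply/mpolyP => a; rewrite mcoeffD mcoeffZ !truncE. Qed.
HB.instance Definition _ :=
  GRing.isLinear.Build Z_q Lambda (MP N) _ trunc trunc_is_linear.

Fact trunc_is_multiplicative : multiplicative trunc.
Proof.
split=> [f g|]; last first.
  apply/mpolyP => a; rewrite truncE mcoeff1 /=; congr (_%:R).
  by rewrite -monalg.mdeg_eq0 mdeg_mon_ext mdeg_eq0.
apply/mpolyP => a; rewrite truncE mcoeffM.
change (mulS f g (mon_ext a) =
  \sum_(k : 'X_{1..N < (mdeg a).+1, (mdeg a).+1} | a == (k.1 + k.2)%MM)
     (trunc f)@_k.1 * (trunc g)@_k.2).
rewrite mulSE.
pose ext2 (k : 'X_{1..N < (mdeg a).+1, (mdeg a).+1}) :=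
  (mon_ext k.1, mon_ext k.2).
have exti : injective mon_ext := can_inj mon_extK.
rewrite (perm_big [seq ext2 k | k <- enum [pred k : 'X_{1..N < (mdeg a).+1, (mdeg a).+1}
  | a == (k.1 + k.2)%MM]]) /=.
  rewrite big_map big_enum_cond /=.
  apply: eq_big => [k|k _]; first by rewrite andbT inE.
  by rewrite !truncE.
have ext2i : injective ext2.
  by move=> [k l] [k' l'] [/exti/val_inj-> /exti/val_inj->].
apply: uniq_perm; rewrite ?(map_inj_uniq ext2i) ?fset_uniq ?enum_uniq //.
move=> [x y]; rewrite mem_splitl /=; apply/eqP/mapP => [xy|[k]]; last first.
  by rewrite mem_enum inE => /eqP ak [-> ->]; rewrite -mon_extD -ak.
have x0 i : (N <= i)%N -> x i = 0%N.
  move=> Ni; have := mon_extO a Ni; rewrite -xy cmM => /eqP.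
  by rewrite addn_eq0 => /andP[/eqP].
have y0 i : (N <= i)%N -> y i = 0%N.
  move=> Ni; have := mon_extO a Ni; rewrite -xy cmM => /eqP.
  by rewrite addn_eq0 => /andP[_ /eqP].
have axy : a = (mon_restr x + mon_restr y)%MM.
  by apply: exti; rewrite mon_extD !mon_restrK.
have xd : (mdeg (mon_restr x) < (mdeg a).+1)%N by rewrite axy mdegD ltnS leq_addr.
have yd : (mdeg (mon_restr y) < (mdeg a).+1)%N by rewrite axy mdegD ltnS leq_addl.
exists (BMultinom xd, BMultinom yd); rewrite ?mem_enum ?inE /ext2 /= ?mon_restrK //.
by rewrite -axy.
Qed.
HB.instance Definition _ :=
  GRing.isMultiplicative.Build Lambda (MP N) trunc trunc_is_multiplicative.

Lemma trunc_sym f : trunc f \is symmetric.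
Proof.
apply/issymP => s; apply/mpolyP => a; rewrite mcoeff_sym !truncE.
case: f => f /= /symseriesP[fs _].
pose r (t : 'S_N) i := if insub i is Some j then val (t j) else i.
have rE (t : 'S_N) (j : 'I_N) : r t j = t j by rewrite /r valK.
have rO (t : 'S_N) i : (N <= i)%N -> r t i = i.
  by move=> Ni; rewrite /r insubN // -leqNgt.
have rK t : cancel (r t) (r (t^-1)%g).
  move=> i; have [iN|Ni] := ltnP i N; last by rewrite !rO.
  by rewrite (rE t (Ordinal iN)) rE permK.
apply: (fs (r s)) => [|i].
  by exists (r (s^-1)%g) => //; move=> i; rewrite -{1}[s]invgK rK.
have [iN|Ni] := ltnP i N; last by rewrite rO // !mon_extO.
by rewrite (rE s (Ordinal iN)) (mon_extE _ (Ordinal iN)) mnmE mon_extE.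
Qed.

Lemma trunc_e j : trunc (e_ _ j) = mesym N _ j.
Proof.
apply/mpolyP => a; rewrite truncE mcoeff_mesym /= /mechar mdeg_mon_ext.
congr ((_ && _)%:R); apply/allP/forallP => [a1 i|a1 i].
  have := a1 i; rewrite -cmE_neq0 mon_extE; case: (a i) => // k.
  by move/(_ isT)/eqP->.
rewrite -cmE_neq0; have [iN|/mon_extO->//] := ltnP i N.
rewrite (mon_extE a (Ordinal iN)); move: (a1 (Ordinal iN)).
by case: (a _) => [|[]].
Qed.

Definition deg_le d (f : Lambda) :=
  forall u : mon, (d < monalg.mdeg u)%N -> f u = 0.

Lemma trunc_eq0 f : deg_le N f -> trunc f = 0 -> f = 0.
Proof.
move=> fN tf0; apply/val_inj/seriesP => u /=.
have [/fN//|uN] := ltnP N (monalg.mdeg u).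
pose big (v : mon) := [fset i in finsupp v | (N <= i)%N]%fset.
have supp_le (v : mon) : (#|` finsupp v| <= monalg.mdeg v)%N.
  rewrite monalg.mdegE card_fset_sum1 big_seq_fsetE /= [leqRHS]big_seq_fsetE /=.
  by apply: leq_sum => i _; rewrite lt0n cmE_neq0 fsvalP.
have fs : permutation_invariant f by case: {tf0 fN} f => f /= /symseriesP[].
elim: {u}_.+1 {-2}u (ltnSn #|` big u|) uN => // k IHk u uk uN.
have [b0|[i]] := fset_0Vmem (big u).
  have /mon_restrK <- : forall i, (N <= i)%N -> u i = 0%N.
    move=> i Ni; apply/eqP; rewrite cmE_eq0; apply/negP => iu.
    by have := in_fset0 i; rewrite -b0 !inE iu Ni.
  by rewrite -truncE tf0 mcoeff0.
rewrite !inE /= => /andP[iu Ni].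
have [j jN ju] : exists2 j, (j < N)%N & j \notin finsupp u.
  have : ~~ (i |` low N `<=` finsupp u)%fset.
    apply/negP => /fsubset_leq_card; rewrite cardfsU1 mem_low ltnNge Ni /= card_fseq.
    rewrite undup_id ?iota_uniq // size_iota.
    by rewrite leqNgt ltnS (leq_trans (supp_le u)).
  case/fsubsetPn => j; rewrite in_fset1U mem_low => /predU1P[->|].
    by rewrite iu.
  by exists j.
pose s l := if l == i then j else if l == j then i else l.
have ij : i != j by apply: contraTneq Ni => ->; rewrite -ltnNge.
have sK : involutive s.
  move=> l; rewrite /s; case: (eqVneq l i) => [->|li].
    by rewrite eqxx eq_sym (negPf ij).
  by case: (eqVneq l j) => [->|lj]; rewrite ?eqxx // (negPf li) (negPf lj).
have sb : bijective s by exists s.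
have [P _ PE] := mon_permute sb.
rewrite -(fs s u (P u) sb (PE u)); apply: IHk; last first.
  by rewrite (mdeg_permute sb (PE u)).
rewrite -ltnS (leq_trans _ uk) // ltnS; apply: fproper_ltn_card.
rewrite fproperE; apply/andP; split.
  apply/fsubsetP => l; rewrite !inE -!cmE_neq0 PE /s => /andP[+ Nl]; rewrite Nl andbT.
  case: (eqVneq l i) => [->|_]; first by rewrite cmE_neq0 (negPf ju).
  by case: (eqVneq l j) => // lj; move: Nl; rewrite lj leqNgt jN.
apply/fsubsetPn; exists i; rewrite !inE ?iu ?Ni // andbT -cmE_neq0 PE /s eqxx.
by rewrite cmE_neq0.
Qed.

End Truncation.

Section Evaluation.
Variable x : nat -> Lambda.

Definition ev N (t : MP N) : Lambda :=
  mmap (in_alg Lambda) (fun i : 'I_N => x i.+1) t.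

Lemma evE N t : @ev N t =
  \sum_(a <- msupp t) t@_a *: \prod_(i < N) x i.+1 ^+ a i.
Proof. by apply: eq_bigr => a _; rewrite /= mulr_algl. Qed.

Lemma evD N t u : @ev N (t + u) = ev t + ev u. Proof. exact: raddfD. Qed.
Lemma evM N t u : @ev N (t * u) = ev t * ev u. Proof. exact: rmorphM. Qed.
Lemma ev1 N : @ev N 1 = 1. Proof. exact: rmorph1. Qed.
Lemma evZ N c t : @ev N (c *: t) = c *: ev t.
Proof. by rewrite /ev mmapZ /= mulr_algl. Qed.
Lemma evX N i : @ev N 'X_i = x i.+1.
Proof. by rewrite /ev mmapX mmap1U. Qed.

Lemma ev_widen N M (NM : (N <= M)%N) t :
  @ev M (t \mPo [tuple 'X_(widen_ord NM i) | i < N]) = ev t.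
Proof.
rewrite [RHS]evE comp_mpolyEX /ev raddf_sum; apply: eq_bigr => a _ /=.
rewrite -/(ev _) evZ comp_mpolyX; congr (_ *: _).
rewrite /ev rmorph_prod; apply: eq_bigr => i _.
by rewrite /= rmorphXn /= tnth_mktuple -/(ev _) evX.
Qed.
End Evaluation.
Arguments ev x [N].

Lemma trunc_ev N t : trunc N (ev (e_ _) t) = t \mPo S N.
Proof.
rewrite evE comp_mpolyEX raddf_sum; apply: eq_bigr => a _.
rewrite /= linearZ comp_mpolyX rmorph_prod; congr (_ *: _).
by apply: eq_bigr => i _; rewrite /= rmorphXn /= tnth_mktuple trunc_e.
Qed.

Lemma ev_e_inj N t : ev (e_ _) t = 0 -> t = 0 :> MP N.
Proof.
move=> t0; apply: msym_fundamental_un0; rewrite -trunc_ev t0; exact: raddf0.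
Qed.

Lemma deg_leM d e f g : deg_le d f -> deg_le e g -> deg_le (d + e) (f * g).
Proof.
move=> fd ge u du; change (mulS f g u = 0); rewrite mulSE.
rewrite big_seq big1 // => -[v w]; rewrite mem_splitl /= => /eqP vw.
have [dv|vd] := ltnP d (monalg.mdeg v); first by rewrite fd ?mul0r.
rewrite ge ?mulr0 // ltnNge; apply/negP => we.
by move: du; rewrite -vw monalg.mdegM ltnNge leq_add.
Qed.

Lemma deg_le1 : deg_le 0 1.
Proof. by move=> u; rewrite lt0n monalg.mdeg_eq0 /= => /negPf->. Qed.

Lemma deg_le_e j : deg_le j (e_ _ j).
Proof. by move=> u /gtn_eqF /= ->. Qed.

Lemma deg_le_ev N d (t : MP N) : (mweight t <= d.+1)%N ->
  deg_le d (ev (e_ _) t).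
Proof.
move=> td u du; rewrite evE.
have -> : forall (r : seq 'X_{1..N}) (F : 'X_{1..N} -> Lambda),
    (\sum_(a <- r) F a : Lambda) u = \sum_(a <- r) F a u.
  move=> r F; elim: r => [|a r IHr]; first by rewrite !big_nil.
  by rewrite !big_cons /= IHr.
rewrite big_seq big1 // => a at_.
have aw : (mnmwgt a <= d)%N.
  by rewrite -ltnS (leq_trans _ td) // (mmeasure_mnm_lt _ at_).
suff ea : deg_le (mnmwgt a) (\prod_(i < N) e_ Z_q i.+1 ^+ a i).
  by rewrite /= ea ?mulr0 // (leq_ltn_trans aw du).
rewrite /mnmwgt; elim/big_ind2: _ => [|????|i _].
- exact: deg_le1.
- exact: deg_leM.
elim: (a i) => [|k IHk]; first exact: deg_le1.
by rewrite exprS mulSn; apply: deg_leM => //; apply: deg_le_e.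
Qed.

Lemma ev_e_surj (f : Lambda) : exists N t, f = @ev (e_ _) N t.
Proof.
have [d fd] := symfun_bounded f; exists d.
have [t [tE tw]] := sym_fundamental (trunc_sym d f); exists t.
apply/eqP; rewrite -subr_eq0; apply/eqP/(@trunc_eq0 d).
  have td : deg_le d (ev (e_ _) t).
    apply/deg_le_ev/(leq_trans tw).
    rewrite mmeasureE; apply/bigmax_leqP_seq => a; rewrite mcoeff_msupp truncE.
    move=> fa _; rewrite ltnS leqNgt; apply: contra fa => da.
    by rewrite fd ?mdeg_mon_ext.
  by move=> u du /=; rewrite fd // td // subr0.
by rewrite raddfB /= trunc_ev tE subrr.
Qed.

Lemma ev_e_h N M (t : MP N) (u : MP M) :
  ev (e_ _) t = ev (e_ _) u -> ev (h_ _) t = ev (h_ _) u.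
Proof.
pose K := maxn N M; have NK : (N <= K)%N by rewrite leq_maxl.
have MK : (M <= K)%N by rewrite leq_maxr.
rewrite -!(ev_widen _ NK) -!(ev_widen _ MK) => /eqP; rewrite -subr_eq0.
rewrite /ev -raddfB => /eqP/ev_e_inj/eqP; rewrite subr_eq0 => /eqP -> //.
Qed.

Definition omega_fun (f : Lambda) : Lambda :=
  ev (h_ _) (projT1 (cid (projT2 (cid (ev_e_surj f))))).

Lemma omega_funE N t : omega_fun (@ev (e_ _) N t) = ev (h_ _) t.
Proof.
apply: ev_e_h; set f := ev _ t; by rewrite -(projT2 (cid (projT2 (cid (ev_e_surj f))))).
Qed.

Lemma ev_e_surj2 (f g : Lambda) :
  exists N t u, f = @ev (e_ _) N t /\ g = @ev (e_ _) N u.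
Proof.
have [N [t ->]] := ev_e_surj f; have [M [u ->]] := ev_e_surj g.
exists (maxn N M).
exists (t \mPo [tuple 'X_(widen_ord (leq_maxl N M) i) | i < N]).
exists (u \mPo [tuple 'X_(widen_ord (leq_maxr N M) i) | i < M]).
by rewrite !ev_widen.
Qed.

Fact omega_fun_is_linear : linear omega_fun.
Proof.
move=> c f g; have [N [t [u [-> ->]]]] := ev_e_surj2 f g.
by rewrite -evZ -evD !omega_funE evD evZ.
Qed.

Fact omega_fun_is_multiplicative : multiplicative omega_fun.
Proof.
split=> [f g|]; last by rewrite -[X in omega_fun X](ev1 (e_ _) 0) omega_funE ev1.
by have [N [t [u [-> ->]]]] := ev_e_surj2 f g; rewrite -evM !omega_funE evM.
Qed.

HB.instance Definition _ := GRing.isLinear.Build Z_q Lambda Lambda _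
  omega_fun omega_fun_is_linear.
HB.instance Definition _ := GRing.isMultiplicative.Build Lambda Lambda
  omega_fun omega_fun_is_multiplicative.

Lemma omega_fun_e j : omega_fun (e_ _ j) = h_ _ j.
Proof.
case: j => [|j]; first by rewrite e_0 h_0 rmorph1.
by rewrite -[e_ _ j.+1](evX (e_ _) (@ord_max j)) omega_funE evX.
Qed.

Lemma sum_coef (I : Type) (r : seq I) (F : I -> Lambda) (u : mon) :
  (\sum_(i <- r) F i : Lambda) u = \sum_(i <- r) F i u.
Proof. by elim: r => [|i r IHr]; rewrite ?big_nil // !big_cons /= IHr. Qed.

Let squarefree (v : mon) := all (fun i => v i == 1%N) (finsupp v).

Lemma squarefreeP (v : mon) : reflect (forall i, (v i <= 1)%N) (squarefree v).
Proof.
apply: (iffP allP) => [v1 i|v1 i]; last by rewrite -cmE_neq0; have := v1 i; case: (v i) => [|[]].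
by have := v1 i; rewrite -cmE_neq0; case: (v i) => // k /(_ isT)/eqP->.
Qed.

Lemma sum_e_h n : (0 < n)%N ->
  \sum_(i < n.+1) (-1) ^+ i *: (e_ Z_q i * h_ Z_q (n - i)) = 0.
Proof.
move=> n0; apply/val_inj/seriesP => u; rewrite sum_coef.
pose L := [seq p <- splitl u | squarefree p.1].
have termE i : ((-1) ^+ i *: (e_ Z_q i * h_ Z_q (n - i))) u =
  \sum_(p <- splitl u) (-1) ^+ i *
    (((monalg.mdeg p.1 == i) && squarefree p.1)%:R *
     (monalg.mdeg p.2 == n - i)%N%:R).
  change ((-1) ^+ i * mulS (e_ Z_q i) (h_ Z_q (n - i)) u =
    \sum_(p <- splitl u) (-1) ^+ i *
      (e_ Z_q i p.1 * h_ Z_q (n - i) p.2)).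
  by rewrite mulSE mulr_sumr.
under eq_bigr do rewrite termE.
rewrite exchange_big /=.
have [un|un] := eqVneq (monalg.mdeg u) n; last first.
  rewrite big_seq big1 // => p; rewrite mem_splitl => /eqP pu.
  rewrite big1 // => i _; have [p1|] := eqVneq; last by rewrite mul0r mulr0.
  have [p2|] := eqVneq (monalg.mdeg p.2); last by rewrite !mulr0.
  by move: un; rewrite -pu monalg.mdegM p1 p2 subnKC ?eqxx // -ltnS.
transitivity (\sum_(p <- L) (-1) ^+ monalg.mdeg p.1 : Z_q).
  rewrite big_filter [RHS]big_mkcond; apply: eq_big_seq => p.
  rewrite mem_splitl => /eqP pu.
  have pn : (monalg.mdeg p.1 < n.+1)%N.
    by rewrite ltnS -un -pu monalg.mdegM leq_addr.
  rewrite (bigD1 (Ordinal pn)) //= big1 ?addr0 => [|i]; last first.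
    by rewrite -val_eqE /= eq_sym => /negPf->; rewrite mul0r mulr0.
  rewrite eqxx -{1}un -pu monalg.mdegM addKn eqxx mulr1 /=.
  by case: ifP; rewrite ?mulr1 ?mulr0.
have [i0 i0u] : exists i, i \in finsupp u.
  apply/fset0Pn/negP => /eqP u0; move: n0.
  by rewrite -un monalg.mdegE u0 big_seq_fset0.
pose x := ucm i0.
pose T (p : mon * mon) := if p.1 i0 == 0%N
  then ((p.1 * x)%M, divcm p.2 x) else (divcm p.1 x, (p.2 * x)%M).
have xE i : x i = (i0 == i) by rewrite /x cmU.
have TL p : p \in L -> [/\ T p \in L, T (T p) = p &
    (-1) ^+ monalg.mdeg (T p).1 = - (-1) ^+ monalg.mdeg p.1 :> Z_q].
  case: p => v w; rewrite mem_filter mem_splitl /= => /andP[/squarefreeP v1 /eqP vw].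
  have u0 : (0 < v i0 + w i0)%N by rewrite -cmM vw lt0n cmE_neq0.
  rewrite {3}/T /T /= mem_filter mem_splitl.
  have [v0|v0] := eqVneq (v i0) 0%N.
    have wK : (divcm w x * x)%M = w.
      apply/eqP/cmP => i; rewrite cmM divcmE xE; case: eqP => [<-|_].
        by rewrite subnK //; move: u0; rewrite v0.
      by rewrite subn0 addn0.
    have vK : divcm (v * x)%M x = v.
      by apply/eqP/cmP => i; rewrite divcmE cmM addnK.
    rewrite /= cmM v0 xE eqxx /= vK wK; split=> //.
      rewrite -mulmA [(x * _)%M]mulmC wK vw eqxx andbT.
      apply/squarefreeP => i; rewrite cmM xE; case: eqP => [<-|_].
        by rewrite v0.
      by rewrite addn0.
    by rewrite monalg.mdegM mdegU addn1 exprS mulN1r.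
  have vK : (divcm v x * x)%M = v.
    apply/eqP/cmP => i; rewrite cmM divcmE xE; case: eqP => [<-|_].
      by rewrite subnK // lt0n.
    by rewrite subn0 addn0.
  have wK : divcm (w * x)%M x = w.
    by apply/eqP/cmP => i; rewrite divcmE cmM addnK.
  have dv0 : divcm v x i0 = 0%N.
    by rewrite divcmE xE eqxx; apply/eqP; rewrite subn_eq0.
  rewrite /= dv0 eqxx vK wK; split=> //.
    rewrite [(w * x)%M]mulmC mulmA vK vw eqxx andbT.
    apply/squarefreeP => i; rewrite divcmE.
    exact: leq_trans (leq_subr _ _) (v1 i).
  by rewrite -{2}vK monalg.mdegM mdegU addn1 exprS mulN1r opprK.
set s := \sum_(p <- L) _.
have sN : s = - s.
  rewrite {1}/s (perm_big (map T L)) /=.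
    rewrite big_map -sumrN; apply: eq_big_seq => p /TL[_ _].
    by move=> ->.
  have Lu : uniq L by rewrite filter_uniq ?fset_uniq.
  have Ti : {in L &, injective T}.
    move=> p p' /TL[_ Tp _] /TL[_ Tp' _] e.
    by rewrite -Tp -Tp' e.
  apply: uniq_perm; rewrite ?map_inj_in_uniq // => p.
  apply/idP/mapP => [pL|[p' /TL[? _ _] ->] //].
  by have [? ? _] := TL p pL; exists (T p).
have : s *+ 2 = 0 by rewrite mulr2n {1}sN addNr.
move/polyP => s2; apply/polyP => k; have := s2 k.
rewrite coefMn !coef0 => /eqP; rewrite Num.Theory.mulrn_eq0 /= => /eqP //.
Qed.

Lemma omega_fun_h j : omega_fun (h_ _ j) = e_ _ j.
Proof.
elim/ltn_ind: j => -[|j] IHj; first by rewrite h_0 e_0 rmorph1.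
have heE : \sum_(i < j.+2) (-1) ^+ i *: (h_ Z_q i * e_ Z_q (j.+1 - i)) = 0.
  transitivity ((-1) ^+ j.+1 *:
    \sum_(i < j.+2) (-1) ^+ i *: (e_ Z_q i * h_ Z_q (j.+1 - i))); last first.
    by rewrite sum_e_h ?scaler0.
  rewrite (reindex_inj rev_ord_inj) scaler_sumr; apply: eq_bigr => i _ /=.
  rewrite subSS subKn -1?ltnS // mulrC scalerA; congr (_ *: _).
  move: (ltn_ord i); rewrite ltnS; move: (nat_of_ord i) => k kj.
  by rewrite -{2}(subnK kj) exprD -mulrA -expr2 sqrr_sign mulr1.
have := congr1 omega_fun (sum_e_h (ltn0Sn j)); rewrite rmorph0 => oE.
move: (etrans oE (esym heE)); rewrite linear_sum /=.
rewrite [X in X = _]big_ord_recl [X in _ = X]big_ord_recl /=.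
rewrite !expr0 !scale1r rmorphM /= omega_fun_e h_0 !mul1r subn0.
under eq_bigr => i _.
  rewrite linearZ rmorphM /= omega_fun_e IHj; last first.
    by rewrite /bump add1n subSS ltnS leq_subr.
  over.
by move=> /= E; apply: (addIr _ E).
Qed.

End OmegaExistence.

Lemma omega_exists :
  exists w : {lrmorphism symfun {poly int} -> symfun {poly int}},
    involutive w /\ forall j, w (h_ _ j) = e_ _ j.
Proof.
exists omega_fun; split=> [f|]; last exact: omega_fun_h.
have [N [t ->]] := ev_e_surj f; rewrite /= omega_funE !evE linear_sum.
apply: eq_bigr => a _; rewrite /= linearZ; congr (_ *: _).
rewrite rmorph_prod; apply: eq_bigr => i _; by rewrite /= rmorphXn /= omega_fun_h.
Qed.

(* Unique, since the h_j generate the algebra of symmetric functions. *)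
Definition omega : {lrmorphism symfun {poly int} -> symfun {poly int}} :=
  projT1 (cid omega_exists).

Lemma omegaK : involutive omega.
Proof. by rewrite /omega; case: cid => w []. Qed.

Lemma omega_h j : omega (h_ _ j) = e_ _ j.
Proof. by rewrite /omega; case: cid => w []. Qed.

Definition qint (n : nat) : {poly int} := \sum_(i < n) 'X^i.

Notation Lambda := (symfun {poly int}).

Fixpoint rho_upto (n : nat) : seq Lambda :=
  if n is n'.+1 then
    let s := rho_upto n' in
    rcons s (qint n *: h_ _ n - \sum_(1 <= i < n) h_ _ i * s`_(n - i).-1)
  else [::].

(* The value at 0 is junk. *)
Definition rho (n : nat) : Lambda := (rho_upto n)`_n.-1.

Lemma size_rho_upto n : size (rho_upto n) = n.
Proof. by elim: n => //= n IHn; rewrite size_rcons IHn. Qed.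

Lemma nth_rho_upto n i : (i < n)%N -> (rho_upto n)`_i = rho i.+1.
Proof.
elim: n => // n IHn; rewrite ltnS leq_eqVlt => /predU1P[-> //|lin].
by rewrite [LHS]/= nth_rcons size_rho_upto lin IHn.
Qed.

Lemma rhoE n : (0 < n)%N ->
  qint n *: h_ _ n = \sum_(i < n) h_ _ i * rho (n - i).
Proof.
case: n => // n _; rewrite big_ord_recl h_0 mul1r subn0 [rho n.+1]/rho /=.
rewrite nth_rcons size_rho_upto ltnn eqxx big_add1 /= big_mkord.
rewrite -[LHS](subrK (\sum_(i < n) h_ _ i.+1 * (rho_upto n)`_(n.+1 - i.+1).-1)).
congr (_ + _); apply: eq_bigr => i _; rewrite /= /bump add1n subSS; congr (_ * _).
have lin : ((n - i).-1 < n)%N.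
  by rewrite (leq_trans _ (leq_subr i n)) // ltn_predL subn_gt0.
by rewrite nth_rho_upto // prednK // subn_gt0.
Qed.

(* The vertex set [n] = {1, ..., n} is represented by 'I_n = {0, ..., n - 1}. *)
Section Hessenberg.
Variables (n : nat) (m : 'I_n -> 'I_n).

Definition hessenberg : Prop :=
  (forall i j : 'I_n, (i <= j)%N -> (m i <= m j)%N) /\
  (forall i : 'I_n, (i <= m i)%N).

Definition hess_graph : rel 'I_n :=
  fun i j => (i < j <= m i)%N || (j < i <= m j)%N.

Definition proper_coloring (kappa : {ffun 'I_n -> nat}) : Prop :=
  forall i j, hess_graph i j -> kappa i <> kappa j.

Definition asc (kappa : {ffun 'I_n -> nat}) : nat :=
  #|[set p : 'I_n * 'I_n | (p.1 < p.2 <= m p.1)%N & (kappa p.1 < kappa p.2)%N]%SET|.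

Definition color_mon (kappa : {ffun 'I_n -> nat}) : mon :=
  \big[mmul/1%M]_(j < n) ucm (kappa j).

(* The set of colorings summed over is finite by finite_color_mon. *)
Definition csf : series {poly int} :=
  Series (fun u => \sum_(kappa \in
    [set kappa | proper_coloring kappa /\ color_mon kappa = u])
      ('X^(asc kappa) : {poly int})).

Lemma finite_color_mon u : finite_set [set kappa | color_mon kappa = u].
Proof.
pose T := {ffun 'I_n -> finsupp u}.
apply: (@sub_finite_set _ _
  ((fun f : T => [ffun j => val (f j)] : {ffun 'I_n -> nat}) @` setT)).
  move=> k /= ku.
  have kj j : k j \in finsupp u.
    rewrite -cmE_neq0 -ku /color_mon (bigD1 j) //= cmM.
    by rewrite cmUU.
  exists [ffun j => [` kj j]%fset] => //.
  by apply/ffunP => j; rewrite !ffunE.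
exact/finite_image/finite_finset.
Qed.

Implicit Types sigma : {perm 'I_n}.

(* The orbit of i is [:: i; sigma i; sigma (sigma i); ...], and enum 'I_n is
   increasing. *)
Definition cycles sigma : seq (seq 'I_n) :=
  [seq fingraph.orbit sigma i |
    i <- enum 'I_n & [forall j in fingraph.orbit sigma i, (i <= j)%N]].

Lemma cycles_flatten_uniq sigma : uniq (flatten (cycles sigma)).
Proof.
have conn_sym := fconnect_sym (@perm_inj _ sigma).
rewrite /cycles -[X in flatten X]/(map _ _).
have -> s : flatten [seq fingraph.orbit sigma i | i <- s] =
            [seq j | i <- s, j <- fingraph.orbit sigma i].
  by congr flatten; apply: eq_map => i; rewrite map_id.
apply: allpairs_uniq_dep => [|i _|].
- by rewrite filter_uniq ?enum_uniq.
- exact: orbit_uniq.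
move=> x y /allpairsPdep[i [k [+ + ->]]] /allpairsPdep[j [l [+ + ->]]] /= ekl.
rewrite -{l}ekl !mem_filter => /andP[/forall_inP imin _] ki.
case/andP=> /forall_inP jmin _ kj; congr existT.
move: ki kj; rewrite -!fconnect_orbit => ki kj.
have ij : fconnect sigma i j.
  by apply: connect_trans ki _; rewrite conn_sym.
apply/val_inj/eqP; rewrite eqn_leq imin -?fconnect_orbit // jmin //.
by rewrite -fconnect_orbit conn_sym.
Qed.

Lemma mem_cycles_flatten sigma i : i \in flatten (cycles sigma).
Proof.
have conn_sym := fconnect_sym (@perm_inj _ sigma).
have Pi : i \in fingraph.orbit sigma i by rewrite -fconnect_orbit connect0.
have [j ji jmin] := @arg_minnP _ i (mem (fingraph.orbit sigma i)) val Pi.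
have ij : fconnect sigma i j by rewrite fconnect_orbit.
apply/flatten_mapP; exists j; last by rewrite -fconnect_orbit conn_sym.
rewrite mem_filter mem_enum andbT; apply/forall_inP => k.
rewrite -fconnect_orbit => jk; apply: jmin.
by rewrite /= -fconnect_orbit; apply: connect_trans jk.
Qed.

Lemma size_cycles_flatten sigma : size (flatten (cycles sigma)) = n.
Proof.
rewrite -[RHS](size_enum_ord n); apply: perm_size; apply: uniq_perm.
- exact: cycles_flatten_uniq.
- exact: enum_uniq.
by move=> i; rewrite mem_cycles_flatten mem_enum.
Qed.

Fact erase_inj sigma : injective (fun i : 'I_n => nth i (flatten (cycles sigma)) i).
Proof.
move=> i j; rewrite (set_nth_default j) ?size_cycles_flatten // => /eqP.
rewrite nth_uniq ?size_cycles_flatten ?cycles_flatten_uniq // => /eqP.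
exact: val_inj.
Qed.
(* The permutation sigma^c. *)
Definition erase sigma : {perm 'I_n} := perm (@erase_inj sigma).

Definition wt sigma : nat :=
  #|[set p : 'I_n * 'I_n | (p.1 < p.2 <= m p.1)%N &
      ((erase sigma)^-1%g p.2 < (erase sigma)^-1%g p.1)%N]%SET|.

(* For k < n; n - k and the exponents below are then genuine differences. *)
Definition g_ (k : nat) : Lambda :=
  \sum_(sigma : {perm 'I_n} | [forall i, (sigma i <= m i)%N] &&
                              (n - k <= size (head [::] (cycles sigma)))%N)
    ((-1) ^+ (size (head [::] (cycles sigma)) - (n - k)) * 'X^(wt sigma)) *:
    (h_ _ (size (head [::] (cycles sigma)) - (n - k)) *
     omega (\prod_(tau <- behead (cycles sigma)) rho (size tau))).

End Hessenberg.

(* Main.v *)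
Require Import Defs.
From HB Require Import structures.
From mathcomp Require Import all_boot all_order all_algebra all_fingroup.
From mathcomp Require Import ring.
From mathcomp Require finmap boolp classical_sets functions cardinality fsbigop.
From mathcomp.multinomials Require monalg mpoly.

Set Implicit Arguments.
Unset Strict Implicit.
Unset Printing Implicit Defensive.

Import GRing.Theory.

Local Open Scope ring_scope.

(* Functions f on subsets of [n] form an algebra under
     (f * g)(X) = sum_{S <= X} q^inv(S, X \ S) f(S) g(X \ S),
   where inv(S, T) counts the edges t < s with s in S and t in T. The chromatic
   quasisymmetric function is the value at [n] of the product, largest color first,
   of the functions C(y) : S |-> y^|S| [S independent].
   Fix a vertex a. Let C'(y) be the part of C(y) on sets lying above a, D(y) the part
   on sets with minimum a, and R_s(S) the sum of q^inv(w) over the words w on S that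
   start with the minimum a of S, |S| = s, and satisfy w_(i+1) <= m(w_i).
   - Switching the colors of components gives C(y) C(z) = C(z) C(y) and
       (z - y) C'(y) D(z) = (z - q y) D(z) C'(y) + (q - 1) z D(y) C'(z).
   - A sign-reversing involution gives D(y) = (sum_s y (-y)^(s-1) R_s) C'(y).
   - Cancelling C'(z) and taking coefficients of z,
       C'(y) (R_s + y R_(s+1)) = (R_s + q y R_(s+1)) C'(y)   for s >= 1.
   Adding the colors one at a time, the product restricted to sets with minimum a is
   (sum_s r_s R_s) times the product of the C'(y), where r_s is the value of
   omega rho_s. Iterating this peels off one cycle at a time, and csf becomes the sum
   over sigma in S_{n,m} of q^wt(sigma) times the product of the omega rho_|tau_i|.
   The formula follows from omega rho_N = sum_j (-1)^(N-j) [j]_q e_j h_(N-j) applied to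
   the first cycle. *)

(** * Subsets of [n] and their smallest elements *)

Section Subsets.
Variable n : nat.
Implicit Types (X S T : {set 'I_n}) (a b s t : 'I_n).

Definition above a X := [forall x in X, (a < x)%N].

Lemma aboveP a X : reflect (forall x, x \in X -> (a < x)%N) (above a X).
Proof. exact: forall_inP. Qed.

Lemma above0 a : above a set0.
Proof. by apply/aboveP => x; rewrite inE. Qed.

Lemma above_notin a X : above a X -> a \notin X.
Proof. by move/aboveP => aX; apply/negP => /aX; rewrite ltnn. Qed.

Lemma above_sub a X S : S \subset X -> above a X -> above a S.
Proof. by move=> /subsetP SX /aboveP aX; apply/aboveP => x /SX/aX. Qed.

Lemma aboveU1 a b X : above a (b |: X) = (a < b)%N && above a X.
Proof.
apply/aboveP/andP => [aX|[ab /aboveP aX] x].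
  split; first by apply: aX; rewrite setU11.
  by apply/aboveP => x xX; apply: aX; rewrite setU1r.
by case/setU1P => [->|/aX].
Qed.

Lemma above_trans a b X : (a < b)%N -> above b X -> above a X.
Proof. by move=> ab /aboveP bX; apply/aboveP => x /bX; apply: ltn_trans. Qed.

Lemma set_min X : X != set0 -> exists b S, above b S /\ X = b |: S.
Proof.
case/set0Pn => i iX; have [b bX bmin] := arg_minnP val iX.
exists b, (X :\ b); rewrite setD1K //; split=> //.
apply/aboveP => x; rewrite !inE => /andP[xb /bmin].
by rewrite leq_eqVlt => /predU1P[/val_inj bx|//]; rewrite bx eqxx in xb.
Qed.

Lemma set_min_ind (P : {set 'I_n} -> Prop) : P set0 ->
  (forall b X, above b X -> P X -> P (b |: X)) -> forall X, P X.
Proof.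
move=> P0 PS X; elim: {X}_.+1 {-2}X (ltnSn #|X|) => // k IHk X Xk.
have [->//|/set_min[b [S [bS XE]]]] := eqVneq X set0.
rewrite XE; apply: PS => //; apply: IHk.
by move: Xk; rewrite XE cardsU1 above_notin // add1n ltnS.
Qed.

Lemma big_subsetU1 (V : nmodType) a X (F : {set 'I_n} -> V) : a \notin X ->
  \sum_(S : {set 'I_n} | S \subset a |: X) F S =
  \sum_(S : {set 'I_n} | S \subset X) F (a |: S) +
  \sum_(S : {set 'I_n} | S \subset X) F S.
Proof.
move=> aX; rewrite (bigID (fun S : {set 'I_n} => a \in S)) /=; congr (_ + _).
  rewrite (reindex_onto (fun S => a |: S) (fun S => S :\ a)) /=; last first.
    by move=> S /andP[_ aS]; rewrite setD1K.
  apply: eq_bigl => S; rewrite setU11 andbT; apply/andP/idP.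
    case=> /subsetP SX /eqP SE; apply/subsetP => x xS.
    have := SX x (setU1r _ xS); rewrite !inE => /predU1P[xa|//].
    by move: xS; rewrite -SE xa setD11.
  move=> SX; rewrite setUS // setU1K // ?eqxx //.
  by apply: contra aX; apply: (subsetP SX).
apply: eq_bigl => S; apply/andP/idP => [[SaX aS]|SX]; last first.
  split; first exact: subset_trans SX (subsetUr _ _).
  by apply: contra aX; apply: (subsetP SX).
apply/subsetP => x xS; have := subsetP SaX x xS.
by rewrite !inE => /predU1P[xa|//]; move: aS; rewrite -xa xS.
Qed.

End Subsets.

(** * Edges, inversions between vertex sets, independent sets *)

Section Interval.
Variables (n : nat) (m : 'I_n -> 'I_n).
Implicit Types (X S T : {set 'I_n}) (a b s t : 'I_n).

Definition adj t s := (t < s <= m t)%N.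

Definition inv S T : nat := (\sum_(s in S) \sum_(t in T) adj t s)%N.

Lemma invU1l a S T : a \notin S -> inv (a |: S) T = (inv [set a] T + inv S T)%N.
Proof. by move=> aS; rewrite /inv big_setU1 // big_set1. Qed.

Lemma inv0r S : inv S set0 = 0%N.
Proof. by rewrite /inv big1 // => s _; rewrite big_set0. Qed.

Lemma inv0l T : inv set0 T = 0%N.
Proof. by rewrite /inv big_set0. Qed.

Lemma sumn_setU S T (F : 'I_n -> nat) : [disjoint S & T] ->
  (\sum_(i in S :|: T) F i = \sum_(i in S) F i + \sum_(i in T) F i)%N.
Proof. by move=> ST; rewrite -bigU //; apply: eq_bigl => i; rewrite !inE. Qed.

Lemma invUl S S' T : [disjoint S & S'] -> inv (S :|: S') T = (inv S T + inv S' T)%N.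
Proof. exact: sumn_setU. Qed.

Lemma invUr S T T' : [disjoint T & T'] -> inv S (T :|: T') = (inv S T + inv S T')%N.
Proof.
by move=> TT'; rewrite /inv -big_split; apply: eq_bigr => s _; apply: sumn_setU.
Qed.

Lemma inv_above a X : above a X -> inv [set a] X = 0%N.
Proof.
move=> /aboveP aX; rewrite /inv big_set1 big1 // => t /aX at_.
by rewrite /adj ltnNge (ltnW at_).
Qed.

Definition indep X := [forall s in X, forall t in X, ~~ adj s t].

Lemma indepP X : reflect {in X &, forall s t, ~~ adj s t} (indep X).
Proof.
apply: (iffP forall_inP) => [Xi s t sX tX|Xi s sX]; first exact: (forall_inP (Xi s sX)).
by apply/forall_inP => t; apply: Xi.
Qed.

Lemma indep0 : indep set0.
Proof. by apply/indepP => s t; rewrite inE. Qed.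

Lemma indepU1 a X : above a X -> indep (a |: X) = above (m a) X && indep X.
Proof.
move=> /aboveP aX; apply/indepP/andP => [Xi|[/aboveP maX /indepP Xi] s t].
  split; last by apply/indepP => s t sX tX; apply: Xi; rewrite setU1r.
  apply/aboveP => x xX; rewrite ltnNge; apply/negP => xm.
  by have := Xi _ _ (setU11 a X) (setU1r a xX); rewrite /adj aX // xm.
case/setU1P => [->|sX] /setU1P[->|tX].
- by rewrite /adj ltnn.
- by rewrite /adj [(_ <= m a)%N]leqNgt maX ?andbF.
- by rewrite /adj ltnNge ltnW ?aX.
- exact: Xi.
Qed.

End Interval.

(** * The algebra of functions on subsets with the q-twisted product *)

Definition subset_alg (K : comNzRingType) n (m : 'I_n -> 'I_n) (q : K) : Type :=
  {ffun {set 'I_n} -> K}.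

Section Algebra.
Variables (K : comNzRingType) (n : nat) (m : 'I_n -> 'I_n) (q : K).
Local Notation A := (subset_alg m q).
Local Notation inv := (inv m).
Implicit Types (X S T : {set 'I_n}) (f g h : A).

(** The linear structure is pointwise. The type is indexed by [m] and [q] so that the twisted
    product below can be its canonical ring structure. *)
HB.instance Definition _ := GRing.Lmodule.copy A {ffun {set 'I_n} -> K^o}.

Definition sa_one : A := [ffun X : {set 'I_n} => (X == set0)%:R].
Definition sa_mul f g : A :=
  [ffun X : {set 'I_n} => \sum_(S : {set 'I_n} | S \subset X) q ^+ inv S (X :\: S) * (f S * g (X :\: S))].

(** Both sides sum over the ordered partitions of X into three blocks; since [inv] is additive in
    each argument, both exponents are the sum of the three pairwise inversion numbers. *)
Fact sa_mulA : associative sa_mul.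
Proof.
move=> f g h; apply/ffunP => X; rewrite !ffunE.
under eq_bigr => S _ do rewrite ffunE !mulr_sumr.
under [RHS]eq_bigr => S _ do rewrite ffunE mulr_suml mulr_sumr.
rewrite [RHS](exchange_big_dep (fun S : {set 'I_n} => S \subset X)) /=; last first.
  by move=> S T SX TS; apply: subset_trans TS SX.
apply: eq_bigr => S SX.
(* From here T is the second block; the outer set on the right is the union of S and T. *)
rewrite [RHS](reindex_onto (fun T => S :|: T) (fun T => T :\: S)) /=; last first.
  by move=> T /andP[_ ST]; rewrite -[in RHS](setID T S) (setIidPr ST).
apply: eq_big => [T|T].
  rewrite subUset SX subsetUl andbT /= subsetD setDUl setDv set0U.
  by rewrite -(sameP eqP setDidPl).
rewrite subsetD => /andP[TX TS].
have dTS : [disjoint T & S] by [].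
have -> : (S :|: T) :\: S = T by rewrite setDUl setDv set0U; apply/setDidPl.
rewrite setDDl [in RHS]invUl 1?disjoint_sym //.
have -> : X :\: S = T :|: (X :\: (S :|: T)).
  apply/setP => x; rewrite !inE negb_or.
  case: (boolP (x \in T)) => [xT|_]; last by rewrite andbT.
  by rewrite (subsetP TX) // andbT (disjointFr dTS).
rewrite invUr; last first.
  by rewrite -setI_eq0; apply/eqP/setP => x; rewrite !inE; case: (x \in T); rewrite ?orbT.
by rewrite !exprD; ring.
Qed.

Fact sa_mul1l : left_id sa_one sa_mul.
Proof.
move=> f; apply/ffunP => X; rewrite ffunE (bigD1 set0) ?sub0set //= big1.
  by rewrite setD0 inv0l ffunE eqxx !mul1r addr0.
by move=> S /andP[_ S0]; rewrite ffunE (negPf S0) mul0r mulr0.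
Qed.

Fact sa_mul1r : right_id sa_one sa_mul.
Proof.
move=> f; apply/ffunP => X; rewrite ffunE (bigD1 X) //= big1.
  by rewrite setDv inv0r ffunE eqxx mulr1 mul1r addr0.
move=> S /andP[SX SnX]; rewrite ffunE setD_eq0.
have /negPf-> : ~~ (X \subset S) by apply: contra SnX => XS; rewrite eqEsubset SX.
by rewrite !mulr0.
Qed.

Fact sa_mulDl : left_distributive sa_mul +%R.
Proof.
move=> f g h; apply/ffunP => X; rewrite !ffunE -big_split /=.
by apply: eq_bigr => S _; rewrite ffunE; ring.
Qed.

Fact sa_mulDr : right_distributive sa_mul +%R.
Proof.
move=> f g h; apply/ffunP => X; rewrite !ffunE -big_split /=.
by apply: eq_bigr => S _; rewrite ffunE; ring.
Qed.

Fact sa_one_neq0 : sa_one != 0.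
Proof.
by apply/eqP => /ffunP/(_ set0); rewrite !ffunE eqxx => /eqP; rewrite oner_eq0.
Qed.

HB.instance Definition _ := GRing.Zmodule_isNzRing.Build A
  sa_mulA sa_mul1l sa_mul1r sa_mulDl sa_mulDr sa_one_neq0.

Fact sa_scaleAl (c : K) f g : c *: (f * g) = (c *: f) * g.
Proof.
apply/ffunP => X; rewrite !ffunE -[LHS]/(c * _) mulr_sumr.
by apply: eq_bigr => S _; rewrite ffunE -[_ *: _]/(c * f S); ring.
Qed.
HB.instance Definition _ := GRing.Lmodule_isLalgebra.Build K A sa_scaleAl.

Fact sa_scaleAr (c : K) f g : c *: (f * g) = f * (c *: g).
Proof.
apply/ffunP => X; rewrite !ffunE -[LHS]/(c * _) mulr_sumr.
by apply: eq_bigr => S _; rewrite ffunE -[_ *: _]/(c * g (X :\: S)); ring.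
Qed.
HB.instance Definition _ := GRing.Lalgebra_isAlgebra.Build K A sa_scaleAr.

Lemma saM f g X : (f * g) X =
  \sum_(S : {set 'I_n} | S \subset X) q ^+ inv S (X :\: S) * (f S * g (X :\: S)).
Proof. by rewrite [LHS]ffunE. Qed.

Lemma sa1 X : (1 : A) X = (X == set0)%:R.
Proof. by rewrite [LHS]ffunE. Qed.

Lemma saD f g X : (f + g) X = f X + g X. Proof. by rewrite ffunE. Qed.
Lemma saZ c f X : (c *: f) X = c * f X. Proof. by rewrite ffunE. Qed.

Lemma saM_set0 f g : (f * g) set0 = f set0 * g set0.
Proof.
rewrite saM (bigD1 set0) //= big1; last by move=> S; rewrite subset0 => /andP[->].
by rewrite setDv inv0l expr0 mul1r addr0.
Qed.

(** The term S = X of the product at X is f(X), and all other terms involve f on smaller sets only,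
    so f is recovered by induction on |X|. *)
Lemma sa_mulIr g : g set0 = 1 -> forall f f', f * g = f' * g -> f = f'.
Proof.
move=> g0 f f' fg; apply/ffunP => X.
elim: {X}_.+1 {-2}X (ltnSn #|X|) => // k IHk X Xk.
have := congr1 (fun h : A => h X) fg; rewrite !saM (bigD1 X) //= [RHS](bigD1 X) //=.
rewrite setDv inv0r g0 expr0 !mul1r !mulr1.
rewrite [X in _ = _ + X](eq_bigr (fun S : {set 'I_n} => q ^+ inv S (X :\: S) * (f S * g (X :\: S)))).
  exact: addIr.
move=> S; rewrite andbC -properEneq => /proper_card SX.
by rewrite IHk // (leq_trans SX).
Qed.

End Algebra.

(** * Exchanging two colors *)

Section TwoColors.
Variables (K : comNzRingType) (n : nat) (m : 'I_n -> 'I_n) (q : K).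
Hypothesis m_mono : forall i j : 'I_n, (i <= j)%N -> (m i <= m j)%N.
Local Notation A := (subset_alg m q).
Local Notation inv := (inv m).
Local Notation indep := (indep m).
Implicit Types (X S T : {set 'I_n}) (a b : 'I_n) (y z : K).

Definition ind_color y : A := [ffun X : {set 'I_n} => y ^+ #|X| * (indep X)%:R].
Local Notation C := ind_color.

Lemma ind_color0 y : C y set0 = 1.
Proof. by rewrite ffunE cards0 indep0 mulr1. Qed.

Lemma ind_colorU1 a y X : above a X ->
  C y (a |: X) = y * ((above (m a) X)%:R * C y X).
Proof.
move=> aX; rewrite !ffunE cardsU1 above_notin // add1n exprS indepU1 //.
by rewrite -mulnb natrM; ring.
Qed.

Lemma invU1l_above a S T : above a S -> above a T -> inv (a |: S) T = inv S T.
Proof. by move=> aS aT; rewrite invU1l ?above_notin // inv_above. Qed.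

Lemma invU1r a S T : above a S -> a \notin T ->
  inv S (a |: T) = (#|[set s in S | (s <= m a)%N]| + inv S T)%N.
Proof.
move=> /aboveP aS aT; rewrite /inv.
under eq_bigr => s sS do rewrite big_setU1 //= /adj aS //=.
rewrite big_split /=; congr (_ + _)%N; rewrite -sum1_card big_mkcond /=.
rewrite [RHS]big_mkcond; apply: eq_bigr => s _; rewrite inE.
by case: (s \in S) => //=; case: (_ <= _)%N.
Qed.

Lemma invU1r_far a S T : above a S -> above (m a) S -> a \notin T ->
  inv S (a |: T) = inv S T.
Proof.
move=> aS /aboveP maS aT; rewrite invU1r //.
suff -> : [set s in S | (s <= m a)%N] = set0 by rewrite cards0.
apply/setP => s; rewrite !inE; case sS: (s \in S) => //=.
by apply/negbTE; rewrite -ltnNge maS.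
Qed.

(* The terms of (C y * C z) (a |: X) in which the minimum a lies in the first,
   respectively second, block. *)
Definition hi a y z X := \sum_(S : {set 'I_n} | S \subset X)
  q ^+ inv S (X :\: S) * (C y (a |: S) * C z (X :\: S)).
Definition lo a y z X := \sum_(S : {set 'I_n} | S \subset X)
  q ^+ inv S (a |: (X :\: S)) * (C y S * C z (a |: (X :\: S))).

Lemma setU1D a X S : a \notin S -> (a |: X) :\: S = a |: (X :\: S).
Proof.
by move=> aS; apply/setP => x; rewrite !inE; case: eqP => // ->; rewrite aS.
Qed.

Lemma setU1DU1 a X S : a \notin X -> (a |: X) :\: (a |: S) = X :\: S.
Proof.
move=> aX; apply/setP => x; rewrite !inE negb_or; case: eqP => //= ->.
by rewrite (negPf aX) andbF.
Qed.

Lemma color2U1 a y z X : above a X ->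
  (C y * C z) (a |: X) = hi a y z X + lo a y z X.
Proof.
move=> aX; rewrite saM big_subsetU1 ?above_notin //; congr (_ + _).
  apply: eq_bigr => S SX; rewrite setU1DU1 ?above_notin //.
  by rewrite invU1l_above // ?(above_sub _ aX) // subsetDl.
by apply: eq_bigr => S SX; rewrite setU1D // above_notin // (above_sub SX).
Qed.

Lemma hi_far a y z X : above a X -> above (m a) X ->
  hi a y z X = y * (C y * C z) X.
Proof.
move=> aX maX; rewrite saM mulr_sumr; apply: eq_bigr => S SX.
by rewrite ind_colorU1 ?(above_sub SX aX) // (above_sub SX maX) /=; ring.
Qed.

Lemma lo_far a y z X : above a X -> above (m a) X ->
  lo a y z X = z * (C y * C z) X.
Proof.
move=> aX maX; rewrite saM mulr_sumr; apply: eq_bigr => S SX.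
have aD : above a (X :\: S) by rewrite (above_sub _ aX) // subsetDl.
rewrite ind_colorU1 // invU1r_far ?(above_sub SX aX) ?(above_sub SX maX) ?above_notin //.
by rewrite (above_sub (subsetDl X S) maX) /=; ring.
Qed.

(** Here b is the only neighbor of a and must lie in the other block. The edge ab gives no factor q,
    since its larger end is in the second block. *)
Lemma hi_next a b y z X : (a < b <= m a)%N -> above b X -> above (m a) X ->
  hi a y z (b |: X) = y * lo b y z X.
Proof.
move=> /andP[ab bm] bX maX; rewrite /hi big_subsetU1 ?above_notin // big1 ?add0r.
  rewrite mulr_sumr; apply: eq_bigr => S SX.
  have aS : above a S by apply: above_trans ab (above_sub SX bX).
  rewrite setU1D; last by rewrite above_notin // (above_sub SX).
  by rewrite ind_colorU1 // (above_sub SX maX) /=; ring.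
move=> S SX; rewrite ind_colorU1; last first.
  by rewrite aboveU1 ab (above_trans ab) // (above_sub SX bX).
by rewrite aboveU1 [(m a < b)%N]ltnNge bm /=; ring.
Qed.

(** As in [hi_next], but now the larger end b of the edge lies in the first block, which gives the
    factor q. *)
Lemma lo_next a b y z X : (a < b <= m a)%N -> above b X -> above (m a) X ->
  lo a y z (b |: X) = q * z * hi b y z X.
Proof.
move=> /andP[ab bm] bX maX; rewrite /lo big_subsetU1 ?above_notin //.
rewrite [X in _ + X]big1 ?addr0.
  rewrite mulr_sumr; apply: eq_bigr => S SX.
  have bS : above b S := above_sub SX bX.
  have bD : above b (X :\: S) by rewrite (above_sub _ bX) // subsetDl.
  rewrite setU1DU1 ?above_notin // invU1r ?aboveU1 ?ab ?(above_trans ab) //; last first.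
    by rewrite above_notin // (above_trans ab).
  have -> : [set s in b |: S | (s <= m a)%N] = [set b].
    apply/setP => s; rewrite !inE; case: eqP => [->|_] //=.
    case sS: (s \in S) => //=; apply/negbTE; rewrite -ltnNge.
    by apply: (aboveP _ _ maX); apply: (subsetP SX).
  rewrite cards1 invU1l_above // add1n exprS (@ind_colorU1 a) ?(above_trans ab) //.
  by rewrite (above_sub _ maX) ?subsetDl //=; ring.
move=> S SX; have bS : b \notin S by rewrite above_notin // (above_sub SX).
have bD : above b (X :\: S) by rewrite (above_sub _ bX) // subsetDl.
rewrite setU1D // (@ind_colorU1 a) ?aboveU1 ?ab ?(above_trans ab) //.
by rewrite [(m a < b)%N]ltnNge bm /=; ring.
Qed.

(** Some c in X is adjacent to a, and by monotonicity of [m] also to b, so that a, b, c form a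
    triangle, which two independent blocks cannot cover. *)
Lemma hi_lo_triangle a b y z X : (a < b <= m a)%N -> above b X -> ~~ above (m a) X ->
  hi a y z (b |: X) = 0 /\ lo a y z (b |: X) = 0.
Proof.
move=> /andP[ab bm] bX /forall_inPn[c cX]; rewrite -leqNgt => cm.
have cbm : (c <= m b)%N by apply: leq_trans cm (m_mono (ltnW ab)).
have far (d : 'I_n) S : (c <= m d)%N -> c \in S -> above (m d) S = false.
  by move=> cd cS; apply/negbTE/forall_inPn; exists c => //; rewrite -leqNgt.
have aS S : S \subset X -> above a (b |: S) && above a S && above b S.
  by move=> SX; rewrite aboveU1 ab (above_trans ab) ?(above_sub SX).
have DX S : X :\: S \subset X by apply: subsetDl.
rewrite /hi /lo !big_subsetU1 ?above_notin //; split; rewrite !big1 ?addr0 // => S SX.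
- have /andP[/andP[? ?] ?] := aS _ SX; have /andP[/andP[? ?] ?] := aS _ (DX S).
  rewrite setU1D ?above_notin // [C y _]ind_colorU1 // [C z _]ind_colorU1 //.
  have [cS|cS] := boolP (c \in S); first by rewrite (far a) //=; ring.
  by rewrite (far b) ?inE ?cS //=; ring.
- have /andP[/andP[? ?] ?] := aS _ SX.
  by rewrite [C y _]ind_colorU1 // aboveU1 [(m a < b)%N]ltnNge bm /=; ring.
- have /andP[/andP[? ?] ?] := aS _ SX; have /andP[/andP[? ?] ?] := aS _ (DX S).
  rewrite setU1D ?above_notin // [C z _]ind_colorU1 //.
  by rewrite aboveU1 [(m a < b)%N]ltnNge bm /=; ring.
- have /andP[/andP[? ?] ?] := aS _ SX; have /andP[/andP[? ?] ?] := aS _ (DX S).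
  rewrite setU1DU1 ?above_notin // [C z _]ind_colorU1 // [C y _]ind_colorU1 //.
  have [cS|cS] := boolP (c \in S); first by rewrite (far b) //=; ring.
  by rewrite (far a) ?inE ?cS //=; ring.
Qed.

(** The two identities are proved together: the symmetry for a follows from the second identity for
    the next vertex b. *)
Lemma hi_lo_swap a y z X : above a X ->
  hi a y z X + lo a y z X = hi a z y X + lo a z y X /\
  (z - y) * lo a y z X = (z - q * y) * hi a z y X + (q - 1) * z * hi a y z X.
Proof.
elim/set_min_ind: X a => [|b X bX IHX] a.
  by move=> a0; rewrite !hi_far ?lo_far ?above0 // !saM_set0 !ind_color0; split; ring.
rewrite aboveU1 => /andP[ab aX]; have [IHs IHm] := IHX b bX.
have [mab|] := boolP (above (m a) (b |: X)).
  have abX : above a (b |: X) by rewrite aboveU1 ab.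
  by rewrite !hi_far ?lo_far // !color2U1 // -IHs; split; ring.
rewrite aboveU1; have [mab|bma _] := ltnP (m a) b; first by rewrite (above_trans mab).
have abm : (a < b <= m a)%N by rewrite ab.
have [maX|maX] := boolP (above (m a) X); last first.
  have [-> ->] := hi_lo_triangle y z abm bX maX.
  by have [-> ->] := hi_lo_triangle z y abm bX maX; split; ring.
rewrite !hi_next // !lo_next //.
have -> : lo b z y X = hi b y z X + lo b y z X - hi b z y X by rewrite IHs addrC addKr.
have /eqP := IHm; rewrite -subr_eq0 => /eqP IHm0.
(* With both sides brought to the left, the two goals are -1 and -z times the second identity for
   b. *)
split; apply/eqP; rewrite -subr_eq0; apply/eqP.
  by rewrite -[RHS](mulr0 (-1)) -IHm0; ring.
by rewrite -[RHS](mulr0 (- z)) -IHm0; ring.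
Qed.

Lemma ind_color_comm y z : C y * C z = C z * C y.
Proof.
apply/ffunP => X; have [->|/set_min[b [S [bS ->]]]] := eqVneq X set0.
  by rewrite !saM_set0 mulrC.
by rewrite !color2U1 //; have [-> _] := hi_lo_swap y z bS.
Qed.

End TwoColors.

(** * Words on a set whose steps obey the Hessenberg bound *)

Section Walks.
Variables (n : nat) (m : 'I_n -> 'I_n).
Implicit Types (S X : {set 'I_n}) (w : seq 'I_n) (v s : 'I_n).

Definition step v s := (s <= m v)%N.

(** The argument [k] is fuel for the recursion on S; [walks] supplies |S|, the exact length of the
    words. *)
Fixpoint walks_rec k v S : seq (seq 'I_n) :=
  if k is k'.+1 then
    flatten [seq [seq s :: w | w <- walks_rec k' s (S :\ s)] | s <- enum S & step v s]
  else [:: [::]].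

Definition walks v S := walks_rec #|S| v S.

Lemma walks0 v : walks v set0 = [:: [::]].
Proof. by rewrite /walks cards0. Qed.

Lemma walksE v S : S != set0 -> walks v S =
  flatten [seq [seq s :: w | w <- walks s (S :\ s)] | s <- enum S & step v s].
Proof.
rewrite -card_gt0 /walks => S0; case E: #|S| S0 => [|k] //= _.
congr flatten; apply/eq_in_map => s; rewrite mem_filter mem_enum => /andP[_ sS].
by move: E; rewrite (cardsD1 s S) sS add1n => -[->].
Qed.

Lemma set_seq0 w : ([set x in w] == set0) = (w == [::]).
Proof.
case: w => [|s w]; first by apply/eqP/setP => x; rewrite !inE.
by apply/eqP => /setP/(_ s); rewrite !inE eqxx.
Qed.

Lemma mem_walks v S w :
  (w \in walks v S) = [&& uniq w, [set x in w] == S & path step v w].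
Proof.
elim: w v S => [|s w IHw] v S.
  rewrite /= andbT; have -> : [set x in [::]] = set0 :> {set 'I_n}.
    by apply/setP => x; rewrite !inE.
  have [->|S0] := eqVneq S set0; first by rewrite walks0.
  rewrite walksE //; apply/negP => /flattenP[l /mapP[s _ ->]].
  by case/mapP.
have [->|S0] := eqVneq S set0.
  by rewrite walks0 set_seq0 andbF.
rewrite walksE //; apply/flatten_mapP/and3P => /=.
  case=> t; rewrite mem_filter mem_enum => /andP[vt tS] /mapP[w' + [st ww']].
  rewrite -{}st -{}ww' in vt tS * => {t w'}; rewrite IHw => /and3P[wu /eqP wS wp].
  have sw : s \notin w by move/setP/(_ s): wS; rewrite !inE eqxx /= => ->.
  by split; rewrite ?sw ?vt // set_cons wS setD1K.
case=> /andP[sw wu] /eqP wS /andP[vs wp]; exists s.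
  by rewrite mem_filter mem_enum vs -wS inE mem_head.
apply/mapP; exists w => //; rewrite IHw wu wp andbT -wS /= set_cons setU1K //.
by rewrite inE.
Qed.

Lemma walks_uniq v S : uniq (walks v S).
Proof.
elim: {S}_.+1 {-2}S (ltnSn #|S|) v => // k IHk S Sk v.
have [->|S0] := eqVneq S set0; first by rewrite walks0.
rewrite walksE //; apply: allpairs_uniq_dep => [|s|]; first by rewrite filter_uniq ?enum_uniq.
- rewrite mem_filter mem_enum => /andP[_ sS]; apply: IHk.
  by move: Sk; rewrite (cardsD1 s S) sS.
- by move=> [s w] [t w'] _ _ /= [-> ->].
Qed.

(** This counts the edges whose larger end comes first in the word; on the concatenated cycles of a
    permutation it is [wt] (see [wt_invw]). *)
Fixpoint invw w : nat := if w is s :: w' then (count (adj m ^~ s) w' + invw w')%N else 0%N.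

Lemma count_adj s w S : uniq w -> [set x in w] = S ->
  count (adj m ^~ s) w = inv m [set s] S.
Proof.
move=> wu <-; rewrite /inv big_set1 -sum1_count big_mkcond -[RHS]big_filter.
rewrite [RHS](perm_big w) /=; first by apply: eq_bigr => x _; case: adj.
apply: uniq_perm; rewrite ?filter_uniq ?index_enum_uniq //.
by move=> x; rewrite mem_filter mem_index_enum inE andbT.
Qed.

Lemma invw_cat w w' : uniq (w ++ w') ->
  invw (w ++ w') = (invw w + invw w' + inv m [set x in w] [set x in w'])%N.
Proof.
elim: w => [|s w IHw] /=.
  by rewrite (_ : [set x in [::]] = set0) ?inv0l ?addn0 //; apply/setP => x; rewrite !inE.
case/andP=> sww' u; rewrite {}IHw // count_cat set_cons invU1l; last first.
  by rewrite inE; apply: contra sww'; rewrite mem_cat => ->.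
rewrite [count _ w'](@count_adj s w' _ _ erefl); first by ring.
by move: u; rewrite cat_uniq => /and3P[].
Qed.

End Walks.

(** * Weighted sums over walks and their alternating identity *)

Section WalkSums.
Variables (K : comNzRingType) (n : nat) (m : 'I_n -> 'I_n) (q : K).
Hypothesis m_mono : forall i j : 'I_n, (i <= j)%N -> (m i <= m j)%N.
Hypothesis m_ge : forall i : 'I_n, (i <= m i)%N.
Implicit Types (S X : {set 'I_n}) (w : seq 'I_n) (v s : 'I_n).

Definition walk_sum v S : K := \sum_(w <- walks m v S) q ^+ invw m w.

Lemma walk_sum0 v : walk_sum v set0 = 1.
Proof. by rewrite /walk_sum walks0 big_seq1. Qed.

Lemma walk_sumE v S : S != set0 -> walk_sum v S =
  \sum_(s in S | step m v s) q ^+ inv m [set s] (S :\ s) * walk_sum s (S :\ s).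
Proof.
move=> S0; rewrite /walk_sum walksE // big_flatten big_map big_filter big_enum_cond /=.
apply: eq_bigr => s /andP[sS _]; rewrite big_map mulr_sumr /=.
apply: eq_big_seq => w; rewrite mem_walks => /and3P[wu /eqP wS _].
by rewrite (count_adj _ _ wu wS) exprD.
Qed.

(* The terms correspond to words whose first part is a walk from v and whose
   second part increases along non-adjacent letters; moving the last letter of
   the first part into the second changes the sign. *)
Lemma walk_sum_indep v X :
  \sum_(S : {set 'I_n} | S \subset X)
    (-1) ^+ #|S| * q ^+ inv m S (X :\: S) * walk_sum v S * (indep m (X :\: S))%:R
  = (indep m X && above (m v) X)%:R.
Proof.
elim: {X}_.+1 {-2}X (ltnSn #|X|) v => // k IHk X Xk v.
rewrite (bigD1 set0) ?sub0set //= cards0 setD0 inv0l walk_sum0 !mul1r.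
have walkD S : (S \subset X) && (S != set0) ->
  (-1) ^+ #|S| * q ^+ inv m S (X :\: S) * walk_sum v S * (indep m (X :\: S))%:R =
  \sum_(s in S | step m v s) (-1) ^+ #|S| * q ^+ inv m S (X :\: S) *
   (q ^+ inv m [set s] (S :\ s) * walk_sum s (S :\ s)) * (indep m (X :\: S))%:R.
  by move=> /andP[_ S0]; rewrite walk_sumE // mulr_sumr mulr_suml.
rewrite {}(eq_bigr _ walkD) (exchange_big_dep (fun s => (s \in X) && step m v s)) /=; last first.
  by move=> S s /andP[SX _] /andP[sS ->]; rewrite (subsetP SX).
(* The walks with first letter s are summed by the induction hypothesis for X without s, walking on
   from s; the removed letter accounts for the sign. *)
have termE s : (s \in X) && step m v s ->
  \sum_(S : {set 'I_n} | (S \subset X) && (S != set0) && ((s \in S) && step m v s))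
    (-1) ^+ #|S| * q ^+ inv m S (X :\: S) *
    (q ^+ inv m [set s] (S :\ s) * walk_sum s (S :\ s)) * (indep m (X :\: S))%:R =
  - (indep m X && above s (X :\ s))%:R.
  move=> /andP[sX vs].
  transitivity (- (q ^+ inv m [set s] (X :\ s) *
      (indep m (X :\ s) && above (m s) (X :\ s))%:R)).
    rewrite -(IHk _ _ s); last by move: Xk; rewrite (cardsD1 s X) sX.
    rewrite mulr_sumr -sumrN.
    rewrite (reindex_onto (fun S => s |: S) (fun S => S :\ s)) /=; last first.
      by move=> S /andP[_ /andP[sS _]]; rewrite setD1K.
    apply: eq_big => [S|S].
      rewrite setU11 vs !andbT /= subUset sub1set sX /= subsetD1.
      have -> : s |: S != set0 by apply/set0Pn; exists s; rewrite setU11.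
      rewrite andbT; congr (_ && _); apply/eqP/idP => [<-|sS]; first by rewrite setD11.
      by rewrite setU1K.
    move=> /andP[/andP[/andP[sSX _] _] /eqP SE].
    have sS : s \notin S by rewrite -SE setD11.
    have SX : S \subset X := subset_trans (subsetUr _ _) sSX.
    rewrite SE cardsU1 sS add1n exprS.
    have -> : X :\: (s |: S) = (X :\ s) :\: S by rewrite setDDl.
    set T := (X :\ s) :\: S.
    have -> : X :\ s = S :|: T.
      apply/setP => x; rewrite !inE; case xS: (x \in S) => //=.
      by rewrite (subsetP SX) // andbT; apply: contraNneq sS => <-.
    rewrite invU1l // invUr ?exprD; first by ring.
    by rewrite -setI_eq0 /T setIDA setIC -setIDA setDv setI0.
  congr (- _); have [aX|naX] := boolP (above s (X :\ s)).
    rewrite inv_above // mul1r andbT -{3}(setD1K sX) indepU1 //.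
    by rewrite andbC.
  (* If s is not the minimum of X, then X without s cannot lie above m(s), because s <= m(s). *)
  rewrite [above (m s) _](_ : _ = false) ?andbF ?mulr0 //.
  apply: contraNF naX => /aboveP aX; apply/aboveP => x /aX.
  exact: leq_ltn_trans.
rewrite {}(eq_bigr _ termE) sumrN.
have [->|/set_min[b [Y [bY XE]]]] := eqVneq X set0.
  by rewrite above0 indep0 big1 ?subr0 // => s; rewrite inE.
have bX : b \in X by rewrite XE setU11.
have [iX|niX] := boolP (indep m X); last by rewrite big1 ?subr0 //= oppr0.
(* Only the minimum b of X contributes: what remains is 1 minus the indicator of b <= m(v), the
   indicator of X lying above m(v). *)
rewrite big_mkcondr (bigD1 b) //= big1 ?addr0 => [|s /andP[sX sb]]; last first.
  rewrite [above _ _](_ : _ = false) ?if_same //.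
  apply/negP => /aboveP/(_ b); rewrite !inE eq_sym sb bX => /(_ isT).
  move: sX sb; rewrite XE => /setU1P[->|]; first by rewrite eqxx.
  by move=> /(aboveP _ _ bY) bs _; rewrite ltnNge ltnW.
rewrite XE setU1K ?above_notin // bY aboveU1 /step ltnNge.
case: leqP => /= [_|vb]; first by rewrite subrr.
by rewrite subr0 (above_trans vb).
Qed.

End WalkSums.

(** * Functions on the sets above a and on the sets with minimum a *)

Section Lead.
Variables (K : comNzRingType) (n : nat) (m : 'I_n -> 'I_n) (q : K) (a : 'I_n).
Hypothesis m_mono : forall i j : 'I_n, (i <= j)%N -> (m i <= m j)%N.
Hypothesis m_ge : forall i : 'I_n, (i <= m i)%N.
Local Notation A := (subset_alg m q).
Local Notation C := (ind_color m q).
Implicit Types (S X Y : {set 'I_n}) (f g : A) (y z : K).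

Definition lead X := (a \in X) && above a (X :\ a).

Lemma leadE X : lead X -> X = a |: X :\ a.
Proof. by move=> /andP[aX _]; rewrite setD1K. Qed.

Lemma leadU1 Y : above a Y -> lead (a |: Y).
Proof. by move=> aY; rewrite /lead setU11 setU1K ?above_notin. Qed.

Lemma lead_ind (P : {set 'I_n} -> Prop) :
  (forall X, ~~ lead X -> P X) -> (forall Y, above a Y -> P (a |: Y)) -> forall X, P X.
Proof.
move=> P0 P1 X; have [lX|] := boolP (lead X); last exact: P0.
by rewrite (leadE lX); apply: P1; case/andP: lX.
Qed.

Definition on_above f := forall X, ~~ above a X -> f X = 0.
Definition on_lead f := forall X, ~~ lead X -> f X = 0.

Lemma leadE_split X S : S \subset X ->
  lead X = (lead S && above a (X :\: S)) || (above a S && lead (X :\: S)).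
Proof.
move=> SX; have XE x : (x \in X) = (x \in S) || (x \in X :\: S).
  by rewrite in_setD; case xS: (x \in S) => //=; rewrite (subsetP SX).
apply/idP/orP.
  move=> /andP[aX /aboveP alX]; have [aS|aS] := boolP (a \in S); [left|right].
    rewrite /lead aS /=; apply/andP; split; apply/aboveP => x.
      by rewrite in_setD1 => /andP[xa xS]; apply: alX; rewrite in_setD1 xa (subsetP SX).
    rewrite in_setD => /andP[xS xX]; apply: alX; rewrite in_setD1 xX andbT.
    by apply: contraNneq xS => ->.
  rewrite /lead in_setD aS aX /=; apply/andP; split; apply/aboveP => x.
    move=> xS; apply: alX; rewrite !inE (subsetP SX) // andbT.
    by apply: contraNneq aS => <-.
  by rewrite !inE => /and3P[xa _ xX]; apply: alX; rewrite !inE xa.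
case=> /andP[].
  move=> /andP[aS /aboveP alS] /aboveP alD; rewrite /lead (subsetP SX) //=.
  apply/aboveP => x; rewrite in_setD1 XE => /andP[xa /orP[xS|/alD//]].
  by apply: alS; rewrite !inE xa.
move=> /aboveP alS /andP[aD /aboveP alD]; rewrite /lead XE aD orbT /=.
apply/aboveP => x; rewrite in_setD1 XE => /andP[xa /orP[/alS//|xD]].
by apply: alD; rewrite in_setD1 xa.
Qed.

Lemma on_lead_mulr f g : on_lead f -> on_above g -> on_lead (f * g).
Proof.
move=> fl ga X nX; rewrite saM big1 // => S SX; move: nX; rewrite (leadE_split SX).
by case/norP; rewrite negb_and => /orP[/fl->|/ga->] _; rewrite ?mul0r !mulr0.
Qed.

Lemma on_lead_mull f g : on_above f -> on_lead g -> on_lead (f * g).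
Proof.
move=> fa gl X nX; rewrite saM big1 // => S SX; move: nX; rewrite (leadE_split SX).
by case/norP=> _; rewrite negb_and => /orP[/fa->|/gl->]; rewrite ?mul0r !mulr0.
Qed.

Lemma on_leadD f g : on_lead f -> on_lead g -> on_lead (f + g).
Proof. by move=> fl gl X nX; rewrite saD fl ?gl ?addr0. Qed.

Lemma above_setU1_self Y : above a (a |: Y) = false.
Proof. by apply/negbTE/negP => /aboveP/(_ a); rewrite setU11 ltnn => /(_ isT). Qed.

Lemma lead_above Y : above a Y -> lead Y = false.
Proof. by move=> /above_notin aY; rewrite /lead (negPf aY). Qed.

Lemma saM_lead_above f g Y : on_lead f -> on_above g -> above a Y ->
  (f * g) (a |: Y) = \sum_(S : {set 'I_n} | S \subset Y)
    q ^+ inv m S (Y :\: S) * (f (a |: S) * g (Y :\: S)).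
Proof.
move=> fl ga aY; rewrite saM big_subsetU1 ?above_notin //.
rewrite [X in _ + X]big1 ?addr0; last first.
  by move=> S SY; rewrite fl ?mul0r ?mulr0 // lead_above // (above_sub SY).
apply: eq_bigr => S SY; rewrite setU1DU1 ?above_notin //.
by rewrite invU1l_above // (above_sub _ aY) // subsetDl.
Qed.

Lemma saM_above_lead f g Y : on_above f -> on_lead g -> above a Y ->
  (f * g) (a |: Y) = \sum_(S : {set 'I_n} | S \subset Y)
    q ^+ inv m S (a |: (Y :\: S)) * (f S * g (a |: (Y :\: S))).
Proof.
move=> fa gl aY; rewrite saM big_subsetU1 ?above_notin //.
rewrite big1 ?add0r; last by move=> S _; rewrite fa ?mul0r ?mulr0 // above_setU1_self.
by apply: eq_bigr => S SY; rewrite setU1D // above_notin // (above_sub SY).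
Qed.

(** In the notation of the overview, [above_color] is C'(y), [lead_color] is D(y) and
    [lead_walk_size i] is R_i. [lead_walk] is the sum of the y (-y)^(s-1) R_s, with the coefficient
    written as -(-y)^s. *)
Definition above_color y : A := [ffun X : {set 'I_n} => (above a X)%:R * C y X].
Definition lead_color y : A := [ffun X : {set 'I_n} => (lead X)%:R * C y X].
Definition lead_walk y : A :=
  [ffun X : {set 'I_n} => (lead X)%:R * (- (- y) ^+ #|X| * walk_sum m q a (X :\ a))].
Definition lead_walk_size i : A :=
  [ffun X : {set 'I_n} => (lead X && (#|X| == i))%:R * walk_sum m q a (X :\ a)].

Lemma above_color_on y : on_above (above_color y).
Proof. by move=> X nX; rewrite ffunE (negPf nX) mul0r. Qed.
Lemma lead_color_on y : on_lead (lead_color y).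
Proof. by move=> X nX; rewrite ffunE (negPf nX) mul0r. Qed.
Lemma lead_walk_on y : on_lead (lead_walk y).
Proof. by move=> X nX; rewrite ffunE (negPf nX) mul0r. Qed.
Lemma lead_walk_size_on i : on_lead (lead_walk_size i).
Proof. by move=> X nX; rewrite ffunE (negPf nX) mul0r. Qed.

Lemma above_color0 y : above_color y set0 = 1.
Proof. by rewrite ffunE above0 ind_color0 mul1r. Qed.

Lemma above_colorE y X : above a X -> above_color y X = C y X.
Proof. by move=> aX; rewrite ffunE aX mul1r. Qed.

Lemma lead_colorE y X : lead X -> lead_color y X = C y X.
Proof. by move=> lX; rewrite ffunE lX mul1r. Qed.

Lemma lead_walkU1 y Y : above a Y ->
  lead_walk y (a |: Y) = y * (- y) ^+ #|Y| * walk_sum m q a Y.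
Proof.
move=> aY; rewrite ffunE leadU1 // mul1r setU1K ?above_notin //.
by rewrite cardsU1 above_notin // add1n exprS; ring.
Qed.

(** At the union of a and Y this is [walk_sum_indep] for walks from a, scaled by y^(|Y|+1): its
    right side says that Y with a added is independent. *)
Lemma lead_walk_color y : lead_walk y * above_color y = lead_color y.
Proof.
apply/ffunP; apply: lead_ind => [X nX|Y aY].
  rewrite (on_lead_mulr (lead_walk_on y) (above_color_on y)) //.
  by rewrite lead_color_on.
rewrite saM_lead_above ?lead_colorE ?leadU1 //; [|exact: lead_walk_on|exact: above_color_on].
rewrite ind_colorU1 // ffunE [_ * (_ ^+ _ * _)]mulrCA -natrM mulnb andbC -(walk_sum_indep q m_ge) !mulr_sumr.
apply: eq_bigr => S SY; rewrite lead_walkU1 ?(above_sub SY) // above_colorE; last first.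
  by rewrite (above_sub _ aY) // subsetDl.
rewrite ffunE -(cardsID S Y) (setIidPr SY) exprD (exprNn y).
by rewrite -signr_odd; ring.
Qed.

Lemma above_color_comm y z :
  above_color y * above_color z = above_color z * above_color y.
Proof.
apply/ffunP => X; have [aX|naX] := boolP (above a X).
  have E u v : (above_color u * above_color v) X = (C u * C v) X.
    rewrite !saM; apply: eq_bigr => S SX.
    by rewrite !above_colorE // ?(above_sub SX) // (above_sub _ aX) // subsetDl.
  by rewrite !E ind_color_comm.
have E u v : (above_color u * above_color v) X = 0.
  rewrite saM big1 // => S SX.
  have [aS|] := boolP (above a S); last first.
    by move/above_color_on->; rewrite mul0r mulr0.
  have [aD|] := boolP (above a (X :\: S)); last first.
    by move/above_color_on->; rewrite !mulr0.
  case/negP: naX; apply/aboveP => x xX; have [xS|xS] := boolP (x \in S).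
    exact: (aboveP _ _ aS).
  by apply: (aboveP _ _ aD); rewrite inE xS.
by rewrite !E.
Qed.

(** The values of D C' and C' D at the union of a and Y are [hi] and [lo], so this is the second
    identity of [hi_lo_swap]. *)
Lemma above_lead_color y z : (z - y) *: (above_color y * lead_color z) =
  (z - q * y) *: (lead_color z * above_color y) +
  ((q - 1) * z) *: (lead_color y * above_color z).
Proof.
apply/ffunP; apply: lead_ind => [X nX|Y aY].
  rewrite saD !saZ (on_lead_mull (above_color_on y) (lead_color_on z)) //.
  rewrite (on_lead_mulr (lead_color_on y) (above_color_on z)) //.
  rewrite (on_lead_mulr (lead_color_on z) (above_color_on y)) //.
  by rewrite !mulr0 addr0.
have hiE u v : (lead_color u * above_color v) (a |: Y) = hi m q a u v Y.
  rewrite saM_lead_above //; [|exact: lead_color_on|exact: above_color_on].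
  apply: eq_bigr => S SY; rewrite lead_colorE ?leadU1 ?(above_sub SY) // above_colorE //.
  by rewrite (above_sub _ aY) // subsetDl.
have loE u v : (above_color u * lead_color v) (a |: Y) = lo m q a u v Y.
  rewrite saM_above_lead //; [|exact: above_color_on|exact: lead_color_on].
  apply: eq_bigr => S SY; rewrite above_colorE ?(above_sub SY) // lead_colorE ?leadU1 //.
  by rewrite (above_sub _ aY) // subsetDl.
by rewrite saD !saZ !hiE loE; have [_ ->] := hi_lo_swap q m_mono y z aY.
Qed.

(** After right multiplication by C'(z), which can be cancelled, [lead_walk_color] and the
    commutation of C'(y) with C'(z) turn this into [above_lead_color]. *)
Lemma above_lead_walk y z : (z - y) *: (above_color y * lead_walk z) =
  (z - q * y) *: (lead_walk z * above_color y) +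
  ((q - 1) * z) *: (lead_walk y * above_color y).
Proof.
apply: (sa_mulIr (above_color0 z)).
rewrite mulrDl -!scalerAl -mulrA lead_walk_color lead_walk_color above_lead_color.
congr (_ *: _ + _); rewrite -[RHS]mulrA above_color_comm mulrA.
by rewrite lead_walk_color.
Qed.

End Lead.

(** * Coefficient extraction in z, giving the relations for the single R_i *)

Section LeadWalkSize.
Variables (K : comNzRingType) (n : nat) (m : 'I_n -> 'I_n) (q : K) (a : 'I_n).
Hypothesis m_mono : forall i j : 'I_n, (i <= j)%N -> (m i <= m j)%N.
Hypothesis m_ge : forall i : 'I_n, (i <= m i)%N.
Implicit Types (S X Y : {set 'I_n}) (y : K).

Lemma walk_sumC v S : walk_sum m q%:P v S = (walk_sum m q v S)%:P.
Proof. by rewrite /walk_sum rmorph_sum; apply: eq_bigr => w _; rewrite /= rmorphXn. Qed.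

Lemma above_colorC y X :
  above_color m q%:P a y%:P X = (above_color m q a y X)%:P.
Proof. by rewrite !ffunE !rmorphM rmorphXn /= !rmorph_nat. Qed.

Lemma lead_walkC y X : lead_walk m q%:P a y%:P X = (lead_walk m q a y X)%:P.
Proof.
by rewrite !ffunE walk_sumC !rmorphM rmorphN rmorphXn rmorphN /= rmorph_nat.
Qed.

(** With z the polynomial variable, the exponent records the size of the set, so the coefficient of
    degree i selects R_i up to sign. *)
Lemma lead_walkX X : lead_walk m q%:P a 'X X =
  (- (-1) ^+ #|X| * ((lead a X)%:R * walk_sum m q a (X :\ a)))%:P * 'X^#|X|.
Proof.
rewrite ffunE walk_sumC [(- 'X) ^+ _]exprNn !polyCM polyCN polyC_exp polyCN polyC1 rmorph_nat.
by ring.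
Qed.

Lemma lead_walk_sizeE i X : lead_walk_size m q a i X =
  (lead a X)%:R * walk_sum m q a (X :\ a) * (i == #|X|)%:R.
Proof. by rewrite ffunE -mulnb natrM eq_sym; ring. Qed.

Lemma coef_monomial_term (b c d : K) e k i :
  (b%:P ^+ e * (c%:P * 'X^k * d%:P))`_i = b ^+ e * (c * d) * (i == k)%:R.
Proof.
rewrite -coefXn -coefCM; apply: (congr1 (fun p : {poly K} => p`_i)).
by rewrite !polyCM polyC_exp; ring.
Qed.

Lemma coef_lead_walk_above y i X :
  ((lead_walk m q%:P a 'X * above_color m q%:P a y%:P) X)`_i =
  - (-1) ^+ i * (lead_walk_size m q a i * above_color m q a y) X.
Proof.
rewrite !saM coef_sum mulr_sumr; apply: eq_bigr => S _.
rewrite lead_walkX above_colorC lead_walk_sizeE.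
rewrite coef_monomial_term.
by case: eqP => [->|_] /=; ring.
Qed.

Lemma coef_above_lead_walk y i X :
  ((above_color m q%:P a y%:P * lead_walk m q%:P a 'X) X)`_i =
  - (-1) ^+ i * (above_color m q a y * lead_walk_size m q a i) X.
Proof.
rewrite !saM coef_sum mulr_sumr; apply: eq_bigr => S _.
rewrite lead_walkX above_colorC lead_walk_sizeE.
rewrite [_%:P * (_ * _)]mulrC coef_monomial_term.
by case: eqP => [->|_] /=; ring.
Qed.

(** This is the coefficient of z^(i+1) in [above_lead_walk]. The term (q - 1) z D(y) has degree 1 in
    z, so it disappears for i > 0. *)
Lemma above_lead_walk_size y i : (0 < i)%N ->
  above_color m q a y * (lead_walk_size m q a i + y *: lead_walk_size m q a i.+1) =
  (lead_walk_size m q a i + (q * y) *: lead_walk_size m q a i.+1) * above_color m q a y.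
Proof.
case: i => // i _; apply/ffunP => X.
have /(congr1 (fun p : {poly K} => p`_i.+2)) :=
  congr1 (fun f : subset_alg m q%:P => f X) (@above_lead_walk _ _ m q%:P a m_mono m_ge y%:P 'X).
have wcC Z : (lead_walk m q%:P a y%:P * above_color m q%:P a y%:P) Z =
    ((lead_walk m q a y * above_color m q a y) Z)%:P.
  rewrite !saM rmorph_sum; apply: eq_bigr => S _.
  by rewrite lead_walkC above_colorC /= !rmorphM rmorphXn.
rewrite saD !saZ wcC ![('X - _) * _]mulrBl -polyCM !coefD !coefN !coefCM !coefXM /=.
rewrite -polyC1 -polyCB -[(q - 1)%:P * 'X * _]mulrA coefCM coefXM /= coefC /= mulr0 addr0.
rewrite !coef_above_lead_walk !coef_lead_walk_above mulrDr mulrDl -scalerAl -scalerAr !saD !saZ.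
rewrite [(-1) ^+ i.+2]exprS; set s := (-1) ^+ i.+1 => E.
(* Since s is a sign, multiplication by -s removes the common factor of the extracted
   coefficients. *)
have s2 : s * s = 1 by rewrite -expr2 sqrr_sign.
rewrite -[LHS]mul1r -[RHS]mul1r -s2.
have := congr1 (fun x => - s * x) E => {}E.
by apply: etrans (etrans _ E) _; ring.
Qed.

End LeadWalkSize.

(** * Solving the two-term relations *)

Section Telescope.
Variables (K : comNzRingType) (q : K) (V : lmodType K).
Implicit Types (v y : K) (f : nat -> K) (F G : nat -> V).

(** The recursion shifts f and updates the initial value, as [telescope_sum] does when its first
    term is split off; [deltaS] is the recurrence at the other end. *)
Fixpoint delta v y f k : K :=
  if k is k'.+1 then delta ((q - 1) * y * f 0%N - y * v) y (fun i => f i.+1) k' else v.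

Lemma deltaS v y f k : delta v y f k.+1 = (q - 1) * y * f k - y * delta v y f k.
Proof. by elim: k v f => [//|k IHk] v f; apply: (IHk _ (fun i => f i.+1)). Qed.

(** Repeated elimination of F(k+1) expands (1 + q y t) / (1 + y t) = 1 + (q - 1) y t - (q - 1) y^2
    t^2 + ..., and ends because F and G vanish at N. *)
Lemma telescope_head y F G N :
  (forall k, F k + y *: F k.+1 = G k + (q * y) *: G k.+1) ->
  F N = 0 -> G N = 0 ->
  F 0%N = if N is N'.+1 then G 0%N + ((q - 1) * y) *: \sum_(k < N') (- y) ^+ k *: G k.+1 else 0.
Proof.
elim: N F G => [//|N IHN] F G FG FN GN.
have := IHN (fun k => F k.+1) (fun k => G k.+1) (fun k => FG k.+1) FN GN.
have -> : F 0%N = G 0%N + (q * y) *: G 1%N - y *: F 1%N by rewrite -FG addrK.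
move=> ->; case: N {IHN FN} GN => [->|N GN]; first by rewrite big_ord0 !scaler0 subr0.
rewrite big_ord_recl expr0 scale1r -addrA; congr (_ + _).
rewrite !scalerDr opprD addrA -scalerBl; congr (_ + _); first by congr (_ *: _); ring.
rewrite -scaleNr !scaler_sumr; apply: eq_bigr => k _.
by rewrite !scalerA; congr (_ *: _); rewrite exprS; ring.
Qed.

(** With F(k) = C' R_(k+1) and G(k) = R_(k+1) C', this moves C' to the right of a combination of the
    R's and absorbs the contribution of D(y), for which v = y. *)
Lemma telescope_sum v y f F G N :
  (forall k, F k + y *: F k.+1 = G k + (q * y) *: G k.+1) ->
  F N = 0 -> G N = 0 ->
  \sum_(k < N) (f k + delta v y f k) *: G k =
  \sum_(k < N) f k *: F k + v *: \sum_(k < N) (- y) ^+ k *: G k.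
Proof.
elim: N v f F G => [|N IHN] v f F G FG FN GN; first by rewrite !big_ord0 scaler0 addr0.
rewrite !big_ord_recl /= expr0 scale1r.
have := IHN ((q - 1) * y * f 0%N - y * v) (fun i => f i.+1) (fun k => F k.+1)
  (fun k => G k.+1) (fun k => FG k.+1) FN GN.
rewrite /bump /= => ->; rewrite (telescope_head FG FN GN).
(* Replacing F(0) gives T the coefficient (q - 1) y f(0) from the first sum and -y v from the
   second: together the updated initial value of [delta]. *)
set T := \sum_(k < N) (- y) ^+ k *: G k.+1.
have -> : \sum_(i < N) (- y) ^+ (1 + i) *: G (1 + i)%N = (- y) *: T.
  by rewrite scaler_sumr; apply: eq_bigr => k _; rewrite scalerA -exprS.
have -> : f 0%N *: (G 0%N + ((q - 1) * y) *: T) = f 0%N *: G 0%N + ((q - 1) * y * f 0%N) *: T.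
  by rewrite scalerDr scalerA [f 0%N * _]mulrC.
have -> : v *: (G 0%N + - y *: T) = v *: G 0%N + (- (y * v)) *: T.
  by rewrite scalerDr scalerA mulrN [v * _]mulrC.
rewrite !scalerDl [X in _ + X]addrCA [X in _ + X]addrA addrACA addrA.
by rewrite !addrA.
Qed.
End Telescope.

(** * Adding the colors one at a time and peeling off the block of the minimum *)

Section ColorRecursion.
Variables (K : comNzRingType) (n : nat) (m : 'I_n -> 'I_n) (q : K).
Hypothesis m_mono : forall i j : 'I_n, (i <= j)%N -> (m i <= m j)%N.
Hypothesis m_ge : forall i : 'I_n, (i <= m i)%N.
Local Notation A := (subset_alg m q).
Local Notation C := (ind_color m q).
Implicit Types (a : 'I_n) (S X Y : {set 'I_n}) (y : K) (xs : seq K).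

(* rho_weight xs k is the value of omega rho_(k+1) at the variables xs: by deltaS,
   1 + (q - 1) * sum_k (rho_weight xs k) t^(k+1) is multiplied by
   (1 + q y t) / (1 + y t) when the variable y is added. *)
Fixpoint rho_weight xs k : K :=
  if xs is y :: xs' then rho_weight xs' k + delta q y y (rho_weight xs') k else 0.

Definition all_color xs : A := \prod_(y <- xs) C y.
Definition all_above a xs : A := \prod_(y <- xs) above_color m q a y.
(** The part of the product of all C'(y) + D(y) with exactly one factor D: the minimum a has exactly
    one color. *)
Fixpoint all_lead a xs : A := if xs is y :: xs' then
  lead_color m q a y * all_above a xs' + above_color m q a y * all_lead a xs' else 0.

Definition geq_set a X := above a X || lead a X.

Lemma geq_set_sub a X S : S \subset X -> geq_set a X -> geq_set a S.
Proof.
move=> SX /orP[aX|]; first by rewrite /geq_set (above_sub SX aX).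
rewrite (leadE_split a SX) => /orP[/andP[lS _]|/andP[aS _]].
  by rewrite /geq_set lS orbT.
by rewrite /geq_set aS.
Qed.

Lemma ind_color_geq a y X : geq_set a X ->
  C y X = (above_color m q a y + lead_color m q a y) X.
Proof.
rewrite saD !ffunE => /orP[aX|lX].
  by rewrite aX lead_above // mul1r mul0r addr0.
rewrite lX; have -> : above a X = false by rewrite (leadE lX) above_setU1_self.
by rewrite mul0r mul1r add0r.
Qed.

Lemma on_above_mul a (f g : A) : on_above a f -> on_above a g -> on_above a (f * g).
Proof.
move=> fa ga X /forall_inPn[x xX]; rewrite -leqNgt => xa; rewrite saM big1 // => S SX.
have nab (T : {set _}) : x \in T -> ~~ above a T.
  by move=> xT; apply/forall_inPn; exists x => //; rewrite -leqNgt.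
have [xS|xS] := boolP (x \in S); first by rewrite fa ?mul0r ?mulr0 // nab.
by rewrite ga ?mulr0 // nab // inE xS.
Qed.

Lemma all_above_on a xs : on_above a (all_above a xs).
Proof.
elim: xs => [|y xs IHxs]; rewrite /all_above ?big_nil ?big_cons.
  by move=> X; rewrite sa1; have [->|//] := eqVneq X set0; rewrite above0.
by apply: on_above_mul => //; apply: above_color_on.
Qed.

Lemma all_lead_on a xs : on_lead a (all_lead a xs).
Proof.
elim: xs => [|y xs IHxs] /=; first by move=> X _; rewrite ffunE.
apply: on_leadD; last by apply: on_lead_mull => //; apply: above_color_on.
by apply: on_lead_mulr; [apply: lead_color_on|apply: all_above_on].
Qed.

Lemma on_lead_mul_eq0 a (f g : A) X : on_lead a f -> on_lead a g -> (f * g) X = 0.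
Proof.
move=> fl gl; rewrite saM big1 // => S SX.
have [/andP[aS _]|/fl->] := boolP (lead a S); last by rewrite mul0r mulr0.
by rewrite gl ?mulr0 // /lead inE aS.
Qed.

(** On sets without elements below a, each C(y) is C'(y) + D(y), and products with two factors D
    vanish because a lies in one block only. *)
Lemma all_color_geq a xs X : geq_set a X ->
  all_color xs X = (all_above a xs + all_lead a xs) X.
Proof.
elim: xs X => [|y xs IHxs] X aX.
  by rewrite /all_color /all_above /= !big_nil addr0.
rewrite /all_color /all_above !big_cons /= -/(all_color _) -/(all_above _ _).
transitivity (((above_color m q a y + lead_color m q a y) *
    (all_above a xs + all_lead a xs)) X).
  rewrite !saM; apply: eq_bigr => S SX.
  by rewrite -ind_color_geq ?(geq_set_sub SX) // -IHxs // (geq_set_sub _ aX) // subsetDl.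
rewrite mulrDl !mulrDr !saD (@on_lead_mul_eq0 a (lead_color _ _ _ _) (all_lead _ _)); [|exact: lead_color_on|exact: all_lead_on].
by rewrite addr0 -!addrA [(_ * all_lead _ _) X + _]addrC.
Qed.

Lemma all_color_above a xs X : above a X -> all_color xs X = all_above a xs X.
Proof.
move=> aX; rewrite (@all_color_geq a) ?/geq_set ?aX // saD all_lead_on ?addr0 //.
by rewrite lead_above.
Qed.

Lemma lead_walk_size_eq0 a i : (n < i)%N -> lead_walk_size m q a i = 0.
Proof.
move=> ni; apply/ffunP => X; rewrite !ffunE.
case: eqP => [Xi|_]; last by rewrite andbF mul0r.
by have := max_card X; rewrite card_ord Xi leqNgt ni.
Qed.

Lemma lead_walk_sum a y :
  lead_walk m q a y = y *: \sum_(k < n) (- y) ^+ k *: lead_walk_size m q a k.+1.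
Proof.
apply/ffunP => X; rewrite saZ sum_ffunE.
under eq_bigr => k _ do rewrite saZ ffunE.
have [lX|nlX] := boolP (lead a X); last first.
  by rewrite ffunE (negPf nlX) mul0r big1 ?mulr0 // => k _; rewrite mul0r mulr0.
have Xn : (#|X|.-1 < n)%N.
  have := max_card X; rewrite card_ord; case: #|X| (cardsD1 a X) => [|//].
  by case/andP: lX => ->.
have X0 : #|X| = #|X|.-1.+1 by rewrite prednK // (cardsD1 a) (andP lX).1.
rewrite (bigD1 (Ordinal Xn)) //= big1 ?addr0 => [|k kX]; last first.
  rewrite [in #|X| == _]X0 eqSS (_ : _ == _ = false) ?mul0r ?mulr0 //.
  by apply: contraNF kX => /eqP Xk; apply/eqP/val_inj.
rewrite ffunE lX -X0 eqxx /= !mul1r [in LHS]X0 exprS; ring.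
Qed.

(** Induction on the colors: D(y) and the older sum, past which C'(y) has to be moved, combine by
    [telescope_sum] into a sum with the new weights. *)
Lemma all_leadE a xs : all_lead a xs =
  (\sum_(k < n) rho_weight xs k *: lead_walk_size m q a k.+1) * all_above a xs.
Proof.
elim: xs => [|y xs IHxs] /=.
  by rewrite big1 ?mul0r // => k _; rewrite scale0r.
rewrite IHxs /all_above big_cons -/(all_above a xs) !mulrA -mulrDl; congr (_ * _).
pose F k := above_color m q a y * lead_walk_size m q a k.+1.
pose G k := lead_walk_size m q a k.+1 * above_color m q a y.
have FG k : F k + y *: F k.+1 = G k + (q * y) *: G k.+1.
  by rewrite /F /G !scalerAr -mulrDr above_lead_walk_size // mulrDl -!scalerAl scalerAr.
have Fn : F n = 0 by rewrite /F lead_walk_size_eq0 ?mulr0.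
have Gn : G n = 0 by rewrite /G lead_walk_size_eq0 ?mul0r.
have := telescope_sum y (rho_weight xs) FG Fn Gn.
rewrite -lead_walk_color // lead_walk_sum -scalerAl !mulr_suml mulr_sumr.
under [in X in _ = X -> _]eq_bigr => k _ do rewrite /F scalerAr.
under [in X in _ + _ *: X]eq_bigr => k _ do rewrite /G scalerAl.
move=> E; rewrite addrC -E; apply: eq_bigr => k _.
by rewrite /G scalerAl.
Qed.

Lemma all_color_set0 xs : all_color xs set0 = 1.
Proof.
elim: xs => [|y xs IHxs]; rewrite /all_color ?big_nil ?big_cons; first by rewrite sa1 eqxx.
by rewrite saM_set0 ind_color0 mul1r.
Qed.

(** The set S holds the letters after a in the cycle of a; the other cycles are left to the coloring
    sum on the complement. *)
Lemma all_colorU1 a xs Y : above a Y -> all_color xs (a |: Y) =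
  \sum_(S : {set 'I_n} | S \subset Y) q ^+ inv m S (Y :\: S) *
    (rho_weight xs #|S| * walk_sum m q a S * all_color xs (Y :\: S)).
Proof.
move=> aY; have lY := leadU1 aY.
rewrite (@all_color_geq a) /geq_set ?lY ?orbT // saD all_above_on ?above_setU1_self //.
rewrite add0r all_leadE saM_lead_above //; last exact: all_above_on; last first.
  move=> X nX; rewrite sum_ffunE big1 // => k _.
  by rewrite saZ lead_walk_size_on ?mulr0.
apply: eq_bigr => S SY; rewrite (@all_color_above a) ?(above_sub _ aY) ?subsetDl //.
have aS := above_sub SY aY.
congr (_ * (_ * _)); rewrite sum_ffunE.
(* The block has |S| + 1 elements, so only the term k = |S| survives, and this index is in range. *)
have Sn : (#|S| < n)%N.
  by have := max_card (a |: S); rewrite card_ord cardsU1 above_notin.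
rewrite (bigD1 (Ordinal Sn)) //= big1 ?addr0 => [|k kS].
  by rewrite saZ ffunE leadU1 // cardsU1 above_notin // eqxx mul1r setU1K ?above_notin.
rewrite saZ ffunE cardsU1 above_notin // add1n eqSS.
rewrite (_ : _ == _ = false) ?andbF ?mul0r ?mulr0 //.
by apply: contraNF kS => /eqP Sk; apply/eqP/val_inj.
Qed.

End ColorRecursion.

(** * Lists of cycles in the canonical order *)

Section CycleLists.
Variables (n : nat) (m : 'I_n -> 'I_n).
Implicit Types (X Y S : {set 'I_n}) (a x : 'I_n) (w tau : seq 'I_n) (c : seq (seq 'I_n)).

(** The single condition that a lies below all later letters says both that a cycle begins with its
    minimum and that the minima increase. The step from the last letter back to a needs no check
    when m(i) >= i. *)
Fixpoint cycle_list c := if c is tau :: c' then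
    (if tau is a :: w then all (fun x => (a < x)%N) (w ++ flatten c') && path (step m) a w
     else false) && cycle_list c'
  else true.

Definition subwalks a Y := [seq w | T <- enum (powerset Y), w <- walks m a T].

(** The first cycle starts at the minimum of X and the rest is treated recursively; [k] is fuel,
    sufficient as soon as it is at least |X|. *)
Fixpoint cycle_lists_rec k X : seq (seq (seq 'I_n)) :=
  if k is k'.+1 then
    if [pick a in X | above a (X :\ a)] is Some a then
      [seq (a :: w) :: c | w <- subwalks a (X :\ a),
                           c <- cycle_lists_rec k' (X :\: [set y in a :: w])]
    else [:: [::]]
  else [:: [::]].

Lemma cycle_lists_rec0 k : cycle_lists_rec k set0 = [:: [::]].
Proof. by case: k => //= k; case: pickP => // a; rewrite inE. Qed.

Lemma cycle_lists_recU1 k a Y : above a Y -> cycle_lists_rec k.+1 (a |: Y) =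
  [seq (a :: w) :: c | w <- subwalks a Y,
                       c <- cycle_lists_rec k (Y :\: [set y in w])].
Proof.
move=> aY /=; case: pickP => [b /andP[]|/(_ a)]; last first.
  by rewrite setU11 setU1K ?above_notin // aY.
case/setU1P => [-> _|bY /aboveP bX].
  rewrite setU1K ?above_notin //; congr flatten; apply: eq_map => w.
  by rewrite set_cons setU1DU1 ?above_notin.
have ab := aboveP _ _ aY _ bY.
have /bX : a \in (a |: Y) :\ b by rewrite !inE eqxx -val_eqE /= (ltn_eqF ab).
by rewrite ltnNge ltnW.
Qed.

Lemma mem_subwalks a Y w : (w \in subwalks a Y) =
  [&& uniq w, [set x in w] \subset Y & path (step m) a w].
Proof.
apply/allpairsPdep/and3P => [[S [x []]]|[wu wY wp]].
  rewrite mem_enum powersetE mem_walks => SY /and3P[wu /eqP wS wp] ->.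
  by rewrite wS.
exists [set x in w], w; rewrite mem_enum powersetE mem_walks; split=> //.
by rewrite wu eqxx wp.
Qed.

Lemma subwalks_uniq a Y : uniq (subwalks a Y).
Proof.
apply: allpairs_uniq_dep => [|S _|]; rewrite ?enum_uniq ?walks_uniq //.
move=> x y /allpairsPdep[S [w [_ + ->]]] /allpairsPdep[S' [w' [_ + ->]]] /= ww'.
by rewrite !mem_walks ww' => /and3P[_ /eqP<- _] /and3P[_ /eqP<- _].
Qed.

Lemma mem_cycle_lists_rec k X c : (#|X| <= k)%N ->
  (c \in cycle_lists_rec k X) =
  [&& uniq (flatten c), [set x in flatten c] == X & cycle_list c].
Proof.
have set_nil : [set x in [::]] = set0 :> {set 'I_n} by apply/setP => x; rewrite !inE.
elim: k X c => [|k IHk] X c Xk.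
  have /eqP-> : X == set0 by rewrite -cards_eq0 -leqn0.
  rewrite cycle_lists_rec0 inE; case: c => [|tau c]; first by rewrite /= set_nil !eqxx.
  by rewrite set_seq0; case: tau => [|a w] //=; rewrite !andbF.
have [->|/set_min[a [Y [aY XE]]]] := eqVneq X set0.
  rewrite cycle_lists_rec0 inE; case: c => [|tau c]; first by rewrite /= set_nil !eqxx.
  by rewrite set_seq0; case: tau => [|a w] //=; rewrite !andbF.
rewrite {}XE in Xk *; rewrite cycle_lists_recU1 //.
have Yk : (#|Y| <= k)%N by move: Xk; rewrite cardsU1 above_notin.
have Dk S : (#|Y :\: S| <= k)%N by apply: (leq_trans _ Yk); apply/subset_leq_card/subsetDl.
apply/allpairsPdep/and3P => [[w [c' []]]|[]].
  rewrite mem_subwalks => /and3P[wu wY wp]; rewrite IHk // => /and3P[cu /eqP cS cl] ->.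
  have memc x : (x \in flatten c') = (x \notin w) && (x \in Y).
    by move/setP/(_ x): cS; rewrite !inE.
  have memw x : x \in w -> x \in Y by move=> xw; apply: (subsetP wY); rewrite inE.
  have setE : [set x in w ++ flatten c'] = Y.
    apply/setP => x; rewrite inE mem_cat memc; case xw: (x \in w) => //=.
    by rewrite memw.
  split.
  - rewrite /= cat_uniq wu cu andbT /= mem_cat memc negb_or.
    rewrite (negPf (above_notin aY)) andbF /= andbT.
    apply/andP; split; first by apply: contra (above_notin aY); apply: memw.
    by apply/hasPn => x; rewrite memc => /andP[].
  - by rewrite /= set_cons setE.
  - rewrite /= wp cl !andbT; apply/allP => x xwc; apply: (aboveP _ _ aY).
    by rewrite -setE inE.
case: c => [|[|b w] c] //=.
  by rewrite set_nil eq_sym => _ /eqP/setP/(_ a); rewrite !inE eqxx.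
case/andP=> bwc; rewrite cat_uniq => /and3P[wu /hasPn wc cu] /eqP cS.
case/andP=> /andP[/allP bl wp] cl.
have ab : b = a.
  have := setU11 a Y; rewrite -cS !inE => /predU1P[//|/bl ba].
  have : b \in a |: Y by rewrite -cS !inE eqxx.
  by case/setU1P => // /(aboveP _ _ aY) ab'; move: ba; rewrite ltnNge ltnW.
subst b; have YE : Y = [set x in w ++ flatten c].
  by rewrite -(setU1K (above_notin aY)) -cS set_cons setU1K // inE.
exists w, c; split=> //.
  rewrite mem_subwalks wu wp andbT; apply/subsetP => x.
  by rewrite YE !inE mem_cat => ->.
rewrite IHk // cu cl andbT; apply/eqP/setP => x; rewrite YE !inE mem_cat.
case xc: (x \in flatten c); last by case: (x \in w).
by have /negPf-> : x \notin w := wc x xc.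
Qed.

Lemma cycle_lists_rec_uniq k X : uniq (cycle_lists_rec k X).
Proof.
elim: k X => [//|k IHk] X /=; case: pickP => // a _.
by apply: allpairs_uniq_dep => [|w _|[w c] [w' c'] _ _ [-> ->]] //; apply: subwalks_uniq.
Qed.

Definition cycle_lists := cycle_lists_rec n setT.

Lemma mem_cycle_lists c : (c \in cycle_lists) =
  [&& uniq (flatten c), [set x in flatten c] == setT & cycle_list c].
Proof. by rewrite mem_cycle_lists_rec // cardsT card_ord. Qed.

Lemma cycle_lists_uniq : uniq cycle_lists.
Proof. exact: cycle_lists_rec_uniq. Qed.

End CycleLists.

(** * The coloring sum as a sum over cycle lists *)

Section CycleSum.
Variables (K : comNzRingType) (n : nat) (m : 'I_n -> 'I_n) (q : K).
Hypothesis m_mono : forall i j : 'I_n, (i <= j)%N -> (m i <= m j)%N.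
Hypothesis m_ge : forall i : 'I_n, (i <= m i)%N.
Implicit Types (X Y S : {set 'I_n}) (xs : seq K).

(** Iteration of [all_colorU1]; [invw_cat] distributes the inversions over the first cycle, the
    remaining cycles and the pairs between them. *)
Lemma all_color_cycle_lists_rec xs k X : (#|X| <= k)%N ->
  all_color m q xs X = \sum_(c <- cycle_lists_rec m k X)
    q ^+ invw m (flatten c) * \prod_(tau <- c) rho_weight q xs (size tau).-1.
Proof.
elim: k X => [|k IHk] X Xk.
  have /eqP-> : X == set0 by rewrite -cards_eq0 -leqn0.
  by rewrite all_color_set0 cycle_lists_rec0 big_seq1 big_nil mulr1.
have [->|/set_min[a [Y [aY XE]]]] := eqVneq X set0.
  by rewrite all_color_set0 cycle_lists_rec0 big_seq1 big_nil mulr1.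
rewrite {}XE in Xk *; rewrite cycle_lists_recU1 // all_colorU1 //.
rewrite !big_allpairs_dep /= big_enum_cond /=.
apply: eq_big => [S|S SY]; first by rewrite powersetE andbT.
rewrite /walk_sum mulr_sumr mulr_suml mulr_sumr; apply: eq_big_seq => w.
rewrite mem_walks => /and3P[wu /eqP wS wp]; rewrite wS IHk; last first.
  by apply: leq_trans (subset_leq_card (subsetDl _ _)) _; move: Xk; rewrite cardsU1 above_notin.
rewrite !mulr_sumr; apply: eq_big_seq => c; rewrite mem_cycle_lists_rec; last first.
  by apply: leq_trans (subset_leq_card (subsetDl _ _)) _; move: Xk; rewrite cardsU1 above_notin.
case/and3P=> cu /eqP cS cl; rewrite big_cons /=.
have memc x : (x \in flatten c) = (x \in Y :\: S) by rewrite -cS inE.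
have memw x : (x \in w) = (x \in S) by rewrite -wS inE.
have wcu : uniq (w ++ flatten c).
  rewrite cat_uniq wu cu andbT; apply/hasPn => x; rewrite memc inE => /andP[xS _].
  by rewrite /= memw.
rewrite invw_cat //.
have aS : above a S by apply: above_sub SY aY.
(* The leading letter a is the minimum, hence never the larger end of an edge. *)
have -> : count (adj m ^~ a) (w ++ flatten c) = 0%N.
  rewrite (@count_adj _ _ _ _ Y) ?inv_above //.
  apply/setP => x; rewrite inE mem_cat memc memw.
  by rewrite inE; case xS: (x \in S) => //=; rewrite (subsetP SY).
have -> : #|S| = size w by rewrite -wS cardsE (card_uniqP wu).
by rewrite add0n wS cS !exprD; ring.
Qed.

Lemma all_color_cycle_lists xs : all_color m q xs setT =
  \sum_(c <- cycle_lists m)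
    q ^+ invw m (flatten c) * \prod_(tau <- c) rho_weight q xs (size tau).-1.
Proof. by apply: all_color_cycle_lists_rec; rewrite cardsT card_ord. Qed.

End CycleSum.

(** * Permutations and cycle lists *)

Section PermutationCycles.
Variables (n : nat) (m : 'I_n -> 'I_n).
Hypothesis m_ge : forall i : 'I_n, (i <= m i)%N.
Implicit Types (sigma : {perm 'I_n}) (x i : 'I_n) (tau w : seq 'I_n) (c : seq (seq 'I_n)).
Local Notation orbit := fingraph.orbit.

Lemma orbit_cons sigma i : orbit sigma i = i :: behead (orbit sigma i).
Proof. by rewrite /orbit -orderSpred. Qed.

Lemma sorted_filter_enum (p : pred 'I_n) :
  sorted (fun i j : 'I_n => (i < j)%N) [seq i <- enum 'I_n | p i].
Proof.
apply: sorted_filter; first by move=> i j k; apply: ltn_trans.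
by change (sorted (relpre val ltn) (enum 'I_n)); rewrite -sorted_map val_enum_ord iota_ltn_sorted.
Qed.

(** The heads are the orbit minima in increasing order, so each head lies below all later orbits;
    the steps inside an orbit are applications of sigma. *)
Lemma cycles_cycle_list sigma : (forall i, (sigma i <= m i)%N) ->
  cycle_list m (cycles sigma).
Proof.
move=> sm; have := cycles_flatten_uniq sigma; rewrite /cycles.
set s := [seq i <- _ | _]; have ss : sorted (fun i j : 'I_n => (i < j)%N) s.
  exact: sorted_filter_enum.
have : {in s, forall i j, j \in orbit sigma i -> (i <= j)%N}.
  by move=> i; rewrite mem_filter => /andP[/forall_inP].
elim: s ss => [//|i s IHs] ss imin.
rewrite /= cat_uniq => /and3P[iu _ su].
rewrite IHs ?(path_sorted ss) //; last by move=> j js; apply: imin; rewrite inE js orbT.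
have := iu; rewrite orbit_cons andbT => /= /andP[iw _]; apply/andP; split.
  apply/allP => x; rewrite mem_cat => /orP[xw|/flatten_mapP[j js xj]].
    rewrite ltn_neqAle imin ?mem_head //; last by rewrite orbit_cons inE xw orbT.
    by rewrite andbT; apply: contraNneq iw => /val_inj ix; rewrite {1}ix.
  have ij : (i < j)%N.
    by move/order_path_min: ss => /(_ (fun _ _ _ => @ltn_trans _ _ _))/allP/(_ j js).
  by rewrite (leq_trans ij) // imin // inE js orbT.
have : fcycle sigma (orbit sigma i) by apply/cycle_orbit/perm_inj.
rewrite orbit_cons /= rcons_path => /andP[+ _].
by apply: sub_path => j k /= /eqP <-; apply: sm.
Qed.

(** The image of x is its cyclic successor in the cycle containing it. *)
Lemma cycles_inj : injective (@cycles n).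
Proof.
move=> sigma sigma' E; apply/permP => x.
have /flattenP[tau tc xt] := mem_cycles_flatten sigma x.
have := tc; rewrite {1}E => /mapP[i' _ t'].
case/mapP: tc => i _ ti.
have nE (s : {perm 'I_n}) j : x \in orbit s j -> next (orbit s j) x = s x.
  by apply: nextE; apply/cycle_orbit/perm_inj.
by rewrite -(nE _ i) -?(nE _ i') -?ti -?t'.
Qed.

(** The permutation sends each letter to its cyclic successor in the list that contains it. *)
Lemma cycles_surj c : c \in cycle_lists m ->
  exists2 sigma : {perm 'I_n}, (forall i, (sigma i <= m i)%N) & cycles sigma = c.
Proof.
rewrite mem_cycle_lists => /and3P[cu /eqP cT cl].
have inc x : x \in flatten c by move/setP/(_ x): cT; rewrite !inE.
pose cyc x := nth [::] c (find (fun tau => x \in tau) c).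
have cyc_mem x : cyc x \in c.
  by apply: mem_nth; rewrite -has_find; apply/hasP; apply/flattenP.
have in_cyc x : x \in cyc x.
  by apply: (nth_find _ (a := fun tau => x \in tau)); apply/hasP; apply/flattenP.
have tau_uniq tau : tau \in c -> uniq tau.
  move=> tc; move: cu; case/splitPr: tc => c1 c2; rewrite flatten_cat cat_uniq /=.
  by rewrite cat_uniq => /and3P[_ _ /and3P[]].
(* A letter in two different lists would occur twice in [flatten c]. *)
have cycE x tau : tau \in c -> x \in tau -> cyc x = tau.
  move=> tc xt; apply: contraTeq cu => ct; have := cyc_mem x.
  rewrite (perm_uniq (perm_flatten (perm_to_rem tc))) /= cat_uniq => cc.
  have : cyc x \in tau :: rem tau c by rewrite -(perm_mem (perm_to_rem tc)).
  rewrite inE (negPf ct) /= => cr; rewrite negb_and negb_and negbK orbA; apply/orP; left.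
  by apply/orP; right; apply/hasP; exists x => //; apply/flattenP; exists (cyc x).
pose f x := next (cyc x) x.
have f_cyc x : cyc (f x) = cyc x by apply: cycE; rewrite ?mem_next.
have f_inj : injective f.
  move=> x y fxy; have cxy : cyc x = cyc y by rewrite -f_cyc fxy f_cyc.
  rewrite -(prev_next (tau_uniq _ (cyc_mem x)) x) -[next _ x]/(f x) fxy cxy.
  by rewrite /f prev_next ?tau_uniq.
have fcyc tau : tau \in c -> fcycle f tau.
  move=> tc; apply: cycle_from_next; first exact: tau_uniq.
  by move=> x xt; rewrite /= /f (cycE x tau).
have cl_tau tau : tau \in c ->
    exists a w, [/\ tau = a :: w, {in w, forall x, (a < x)%N} & path (step m) a w].
  elim: (c) cl => [//|tau' c' IHc] /= /andP[+ cl].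
  case: tau' => // a w /andP[/allP al wp]; rewrite inE => /predU1P[->|/(IHc cl)//].
  by exists a, w; split=> // x xw; apply: al; rewrite mem_cat xw.
have heads_sorted : sorted (fun i j : 'I_n => (i < j)%N) (pmap ohead c).
  elim: (c) cl => [//|[//|a w] c' IHc] /= /andP[/andP[/allP al _] cl].
  have := IHc cl; rewrite (path_sortedE (fun _ _ _ => @ltn_trans _ _ _)) => ->.
  rewrite andbT; apply/allP => b; rewrite mem_pmap => /mapP[tau tc' tb]; apply: al.
  rewrite mem_cat; apply/orP; right; apply/flattenP; exists tau => //.
  by case: tau tb tc' => // b' w' [->] _; rewrite mem_head.
have orb x : orbit (perm f_inj) x = orbit f x.
  have E : perm f_inj =1 f by move=> y; rewrite permE.
  rewrite /orbit; have -> : fingraph.order (perm f_inj) x = fingraph.order f x.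
    by apply: eq_card => y; apply: eq_fconnect.
  by elim: (fingraph.order f x) {1 3}x => //= k IHk y; rewrite E IHk.
have orbE tau a w : tau \in c -> tau = a :: w -> orbit f a = tau.
  move=> tc tE; rewrite -[RHS]undup_id ?tau_uniq // tE.
  by rewrite (@undup_cycle_cons _ f) // -tE fcyc.
exists (perm f_inj) => [x|].
  rewrite permE; have [a [w [tE al wp]]] := cl_tau _ (cyc_mem x).
  (* The closing step obeys the bound: the head a is at most the last letter b, and b <= m(b). *)
  have cp : path.cycle (step m) (cyc x).
    rewrite tE /= rcons_path wp /=; case/lastP: w al {tE wp} => [|w b] al /=.
      by rewrite /step m_ge.
    by rewrite last_rcons /step (leq_trans _ (m_ge b)) // ltnW // al // mem_rcons mem_head.
  exact: (next_cycle cp).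
(* Orbit minima and heads of c are both strictly increasing, so it suffices that they have the same
   elements. *)
have headsE : [seq i <- enum 'I_n | [forall j in orbit (perm f_inj) i, (i <= j)%N]]
    = pmap ohead c.
  apply: (irr_sorted_eq (leT := fun i j : 'I_n => (i < j)%N)) => //.
  - by move=> i j k; apply: ltn_trans.
  - by move=> i; apply: ltnn.
  - exact: sorted_filter_enum.
  move=> i; rewrite mem_filter mem_enum andbT mem_pmap orb.
  apply/forall_inP/mapP => [imin|[tau tc]].
    have [a [w [tE al _]]] := cl_tau _ (cyc_mem i).
    exists (cyc i) => //; rewrite tE /=; congr Some; apply/val_inj/eqP.
    have ci : i \in a :: w by rewrite -tE.
    have oa : a \in orbit f i.
      have ac : a \in cyc i by rewrite tE mem_head.
      by rewrite (in_orbit_cycle (fcyc _ (cyc_mem i)) (in_cyc i) ac).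
    rewrite eqn_leq imin ?oa // andTb.
    by move: ci; rewrite inE => /predU1P[->//|/al/ltnW].
  have [a [w [tE al _]]] := cl_tau _ tc.
  rewrite tE => -[->] j; rewrite (orbE tau a w) // tE inE => /predU1P[->//|/al/ltnW//].
rewrite /cycles headsE; elim: {-2}c (fun tau (tc : tau \in c) => tc) => [//|tau c' IHc] sub.
have tc : tau \in c by apply: sub; rewrite mem_head.
have [a [w [tE _ _]]] := cl_tau _ tc.
rewrite [in LHS]tE /= orb (orbE tau a w) // IHc // => tau' t'; apply: sub.
by rewrite inE t' orbT.
Qed.

Lemma sum_cycles (V : nmodType) (F : seq (seq 'I_n) -> V) :
  \sum_(sigma : {perm 'I_n} | [forall i, (sigma i <= m i)%N]) F (cycles sigma) =
  \sum_(c <- cycle_lists m) F c.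
Proof.
rewrite -[LHS]big_filter -(big_map (@cycles n) xpredT).
apply: perm_big; apply: uniq_perm.
- by rewrite map_inj_uniq ?filter_uniq ?index_enum_uniq //; apply: cycles_inj.
- exact: cycle_lists_uniq.
move=> c; apply/mapP/idP => [[sigma]|cc].
  rewrite mem_filter => /andP[/forallP sm _] ->.
  rewrite mem_cycle_lists cycles_flatten_uniq cycles_cycle_list // andbT /=.
  by apply/eqP/setP => x; rewrite !inE mem_cycles_flatten.
have [sigma sm sE] := cycles_surj cc; exists sigma => //.
by rewrite mem_filter mem_index_enum andbT; apply/forallP.
Qed.

(** A new first letter s precedes all others, so the new inversions are exactly the edges with
    larger end s. *)
Lemma invw_index w : uniq w -> invw m w =
  #|[set p : 'I_n * 'I_n | [&& p.1 \in w, p.2 \in w, adj m p.1 p.2 &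
      (index p.2 w < index p.1 w)%N]]|.
Proof.
elim: w => [_|s w IHw] /=; first by apply/esym/eqP; rewrite cards_eq0; apply/eqP/setP => p; rewrite !inE.
move=> /andP[sw wu]; rewrite {}IHw //.
rewrite -size_filter -(card_uniqP (filter_uniq _ wu)).
rewrite -(card_imset _ (_ : injective (fun t : 'I_n => (t, s)))); last by move=> t t' [].
rewrite -cardsUI [X in (_ + X)%N](_ : _ = 0%N) ?addn0; last first.
  apply/eqP; rewrite cards_eq0; apply/eqP/setP => p; rewrite !inE.
  apply/negP => /andP[/imsetP[t _ ->]] /=; by rewrite (negPf sw) andbF.
apply: eq_card => -[t u]; rewrite !inE /=.
have -> : ((t, u) \in [set (t, s) | t in [pred x in [seq t <- w | adj m t s]]]) =
    (u == s) && (t \in w) && adj m t s.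
  apply/imsetP/andP => [[t']|[/andP[/eqP -> tw] ts]].
    by rewrite !inE mem_filter => /andP[ts tw] [-> ->]; rewrite eqxx tw.
  by exists t => //; rewrite !inE mem_filter ts.
rewrite ![s == _]eq_sym; have [->|us] := eqVneq u s.
  rewrite (negPf sw) /= andbF orbF; have [->|ts] := eqVneq t s.
    by rewrite (negPf sw) /= ltnn andbF.
  by rewrite /= andbT.
have [->|ts] := eqVneq t s; first by rewrite (negPf sw) /= ltn0 !andbF.
by rewrite /= ltnS.
Qed.

Lemma wt_invw sigma : wt m sigma = invw m (flatten (cycles sigma)).
Proof.
set w := flatten _; have wu : uniq w := cycles_flatten_uniq sigma.
have eE x : (erase sigma)^-1%g x = index x w :> nat.
  have xw : (index x w < n)%N by rewrite -[ltnRHS](size_cycles_flatten sigma) index_mem mem_cycles_flatten.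
  suff -> : (erase sigma)^-1%g x = Ordinal xw by [].
  apply: (@perm_inj _ (erase sigma)); rewrite permKV permE /=.
  by rewrite nth_index ?mem_cycles_flatten.
rewrite invw_index //; apply: eq_card => -[i j]; rewrite !inE /= !eE.
by rewrite !mem_cycles_flatten.
Qed.

End PermutationCycles.

(** * The recurrence tying the weights to elementary polynomials *)

Section ElementaryWeights.
Variables (K : comNzRingType) (q : K).
Implicit Types (xs : seq K) (y : K).

Definition elem xs j : K := (\prod_(y <- xs) (1 + y%:P * 'X))`_j.

Lemma elem0 xs : elem xs 0 = 1.
Proof.
elim: xs => [|y xs IHxs]; rewrite /elem ?big_nil ?big_cons ?coef1 //.
by rewrite mulrDl mul1r coefD -mulrA coefCM coefXM mulr0 addr0.
Qed.

Lemma elem_cons y xs j : elem (y :: xs) j.+1 = elem xs j.+1 + y * elem xs j.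
Proof. by rewrite /elem big_cons mulrDl mul1r coefD -mulrA coefCM coefXM. Qed.

(** This is the image under omega of the recursion defining rho, in the variables xs. It identifies
    [rho_weight] in [trunc_omega_rho]. *)
Lemma elem_rho_weight xs j : (\sum_(i < j) q ^+ i) * elem xs j =
  \sum_(i < j) elem xs i * rho_weight q xs (j - i.+1).
Proof.
elim: xs j => [|y xs IHxs] j.
  rewrite /= [RHS]big1 => [|i _]; last by rewrite mulr0.
  by case: j => [|j]; rewrite ?big_ord0 ?mul0r // /elem big_nil coef1 mulr0.
case: j => [|j]; first by rewrite !big_ord0 mul0r.
set r' := rho_weight q (y :: xs); set r := rho_weight q xs.
have r0 : r' 0%N = r 0%N + y by [].
(* This says that the generating function changes by the factor (1 + q y t) / (1 + y t), while that
   of the elementary polynomials gains 1 + y t. *)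
have rS k : r' k.+1 = r k.+1 + q * y * r k - y * r' k.
  by rewrite -[LHS]/(r k.+1 + delta q y y r k.+1) -[r' k]/(r k + delta q y y r k) deltaS; ring.
have -> : \sum_(i < j.+1) elem (y :: xs) i * r' (j.+1 - i.+1)%N =
    \sum_(i < j.+1) elem xs i * r' (j - i)%N +
    y * \sum_(i < j) elem xs i * r' (j - i.+1)%N.
  rewrite !big_ord_recl !elem0 -addrA; congr (_ + _).
  rewrite mulr_sumr -big_split; apply: eq_bigr => i _ /=.
  by rewrite /bump add1n elem_cons subSS; ring.
rewrite [X in _ = X + _]big_ord_recr /= subnn r0 [y * \sum_(_ < _) _]mulr_sumr addrAC -big_split /=.
have -> : \sum_(i < j) (elem xs i * r' (j - i)%N + y * (elem xs i * r' (j - i.+1)%N)) =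
    \sum_(i < j) elem xs i * r (j - i)%N + q * y * \sum_(i < j) elem xs i * r (j - i.+1)%N.
  rewrite mulr_sumr -big_split; apply: eq_bigr => i _ /=.
  by rewrite -(subnSK (ltn_ord i)) rS; ring.
have := IHxs j.+1; rewrite big_ord_recr [X in _ = X]big_ord_recr /= subnn -/r => E.
have -> : \sum_(i < j) elem xs i * r (j - i)%N =
   (\sum_(i < j) q ^+ i + q ^+ j) * elem xs j.+1 - elem xs j * r 0%N.
  by rewrite E addrK.
rewrite -IHxs elem_cons.
(* The q-integer of j + 1 with its first term split off instead of its last. *)
have -> : \sum_(i < j) q ^+ i + q ^+ j = 1 + q * \sum_(i < j) q ^+ i.
  rewrite -[LHS](big_ord_recr j (fun i => q ^+ i)) big_ord_recl mulr_sumr /=.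
  by congr (_ + _); apply: eq_bigr => i _; rewrite exprS.
by ring.
Qed.

End ElementaryWeights.

(** * The algebra product as a sum over proper colorings *)

Section Colorings.
Variables (K : comNzRingType) (n : nat) (m : 'I_n -> 'I_n) (q : K) (N : nat).
Variable x : nat -> K.
Implicit Types (X S : {set 'I_n}) (kappa : {ffun 'I_n -> 'I_N.+1}).

(** Reversed, because the first factor of the product carries the largest color. *)
Definition xseq k := [seq x i | i <- rev (iota 0 k)].

(* Partial colorings are given the junk color 0 outside X. *)
Definition coloring_of k X kappa :=
  [forall i, if i \in X then (kappa i < k)%N else kappa i == ord0] &&
  [forall i in X, forall j in X, adj m i j ==> (kappa i != kappa j)].

Definition asc_of X kappa : nat :=
  (\sum_(j in X) \sum_(i in X) (adj m i j && (kappa i < kappa j)))%N.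

(** The first factor chooses the independent set S of vertices of the top color, and the others
    color the complement with smaller colors. *)
Lemma all_color_coloring k X : (k <= N.+1)%N ->
  all_color m q (xseq k) X = \sum_(kappa | coloring_of k X kappa)
    q ^+ asc_of X kappa * \prod_(i in X) x (kappa i).
Proof.
elim: k X => [|k IHk] X kN.
  rewrite /all_color big_nil sa1; have [->|/set0Pn[i iX]] := eqVneq X set0.
    rewrite (bigD1 [ffun=> ord0]) /=; last first.
      apply/andP; split; first by apply/forallP => i; rewrite inE ffunE.
      by apply/forall_inP => i; rewrite inE.
    rewrite [X in _ + X]big1 ?addr0; first by rewrite /asc_of !big_set0 expr0 mulr1.
    move=> kappa /andP[/andP[/forallP k0 _] /negP[]]; apply/eqP/ffunP => i.
    by have := k0 i; rewrite inE ffunE => /eqP.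
  by rewrite big1 // => kappa /andP[/forallP/(_ i)]; rewrite iX.
pose top := Ordinal kN.
rewrite /all_color /xseq -addn1 iotaD add0n rev_cat /= big_cons -/(xseq k) -/(all_color _ _ _) saM.
rewrite (partition_big (fun kappa => [set i in X | kappa i == top])
  (fun S => S \subset X)) /=; last first.
  by move=> kappa _; apply/subsetP => i; rewrite inE => /andP[].
apply: eq_bigr => S SX; rewrite IHk 1?ltnW // ffunE.
(* Colorings with top color class S correspond to colorings of the complement, which take the junk
   color on S. *)
rewrite [RHS](reindex_onto
  (fun kappa => [ffun i => if i \in S then top else kappa i] : {ffun 'I_n -> 'I_N.+1})
  (fun kappa => [ffun i => if i \in S then ord0 else kappa i])) /=; last first.
  move=> kappa /andP[_ /eqP SE]; apply/ffunP => i; rewrite !ffunE -SE inE.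
  by case: (boolP (_ && _)) => [/andP[_ /eqP->]|].
have [iS|niS] := boolP (indep m S); last first.
  rewrite mulr0 mul0r mulr0 big1 // => kappa /andP[/andP[/andP[_ kp] _] _].
  case/negP: niS; apply/indepP => s t sS tS; apply/negP => st.
  move: kp => /forall_inP/(_ s (subsetP SX _ sS))/forall_inP/(_ t (subsetP SX _ tS)).
  by rewrite st !ffunE sS tS eqxx.
rewrite mulr1 mulrA mulr_sumr; apply: eq_big => [kappa|kappa].
  apply/esym; apply/andP/andP.
  - case=> /andP[/andP[/forallP kc /forall_inP kp] /eqP SE] /eqP kE.
    have kS i : i \in S -> kappa i = ord0.
      by move=> iS'; have := congr1 (fun f : {ffun _} => f i) kE; rewrite !ffunE iS'.
    split.
      apply/forallP => i; rewrite in_setD; have := kc i; rewrite !ffunE.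
      have := congr1 (fun T : {set 'I_n} => i \in T) SE; rewrite !inE !ffunE.
      case iS': (i \in S) => /=; first by rewrite kS.
      case iX: (i \in X) => //= it; rewrite addn1 ltnS leq_eqVlt => /predU1P[ik|//].
      by move/eqP: it; case; apply/val_inj.
    apply/forall_inP => i; rewrite in_setD => /andP[iS' iX]; apply/forall_inP => j.
    rewrite in_setD => /andP[jS jX]; have /forall_inP/(_ j jX) := kp i iX.
    by rewrite !ffunE (negPf iS') (negPf jS).
  - case=> /forallP kc /forall_inP kp.
    have kS i : i \in S -> kappa i = ord0.
      by move=> iS'; have := kc i; rewrite in_setD iS' => /eqP.
    have kD i : i \in X -> i \notin S -> (kappa i < k)%N.
      by move=> iX iS'; have := kc i; rewrite in_setD iS' iX.
    have ne i : i \in X -> i \notin S -> kappa i != top.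
      by move=> iX iS'; rewrite -val_eqE /= ltn_eqF ?kD.
    split; last first.
      by apply/eqP/ffunP => i; rewrite !ffunE; case: (boolP (i \in S)) => // /kS.
    apply/andP; split; [apply/andP; split|].
    + apply/forallP => i; rewrite ffunE; case iS': (i \in S).
        by rewrite (subsetP SX) //= addn1.
      case iX: (i \in X); first by rewrite addn1 ltnS ltnW // kD ?iS'.
      by have := kc i; rewrite in_setD iX andbF.
    + apply/forall_inP => i iX; apply/forall_inP => j jX; apply/implyP => ij.
      rewrite !ffunE; case: (boolP (i \in S)) => iS'; case: (boolP (j \in S)) => jS.
      * by have := indepP _ _ iS i j iS' jS; rewrite ij.
      * by rewrite eq_sym ne.
      * by rewrite ne.
      * have iD : i \in X :\: S by rewrite in_setD iS'.
        have jD : j \in X :\: S by rewrite in_setD jS.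
        by have /forall_inP/(_ j jD) := kp i iD; rewrite ij.
    + apply/eqP/setP => i; rewrite inE ffunE; case: (boolP (i \in S)) => iS'.
        by rewrite (subsetP SX) ?eqxx.
      by case iX: (i \in X) => //=; apply/negbTE/ne.
case/andP=> /forallP kc _; set kap := [ffun i => if i \in S then top else kappa i].
have kapS i : i \in S -> kap i = top by rewrite ffunE => ->.
have kapD i : i \notin S -> kap i = kappa i by rewrite ffunE => /negPf->.
have kD i : i \in X -> i \notin S -> (kappa i < k)%N.
  by move=> iX iS'; have := kc i; rewrite in_setD iS' iX.
have inX i : (i \in X) && (i \in S) = (i \in S).
  by case: (boolP (i \in S)) => [/(subsetP SX)->|]; rewrite ?andbF.
have inD i : (i \in X) && (i \notin S) = (i \in X :\: S) by rewrite in_setD andbC.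
have -> : \prod_(i in X) x (kap i) = x k ^+ #|S| * \prod_(i in X :\: S) x (kappa i).
  rewrite (bigID (mem S)) /=; congr (_ * _).
    by rewrite (eq_bigl _ _ inX) -prodr_const; apply: eq_bigr => i /kapS->.
  by apply: eq_big => // i /andP[_ /kapD->].
(* There are no ascents inside S or from S to its complement, and every edge from the complement up
   to S is one; [inv] counts the latter. *)
have -> : asc_of X kap = (inv m S (X :\: S) + asc_of (X :\: S) kappa)%N.
  rewrite /asc_of (bigID (mem S)) /=; congr (_ + _)%N.
    rewrite (eq_bigl _ _ inX); apply: eq_bigr => j jS.
    rewrite (bigID (mem S)) /= big1 ?add0n => [|i /andP[_ iS']]; last first.
      by rewrite !kapS // ltnn andbF.
    by apply: eq_big => // i /andP[iX iS']; rewrite (kapS j) // (kapD i) //= kD // andbT.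
  apply: eq_big => // j /andP[jX jS]; rewrite (bigID (mem S)) /= big1 ?add0n; last first.
    by move=> i /andP[_ iS']; rewrite (kapS i) // (kapD j) //= ltnNge ltnW ?kD ?andbF.
  by apply: eq_big => // i /andP[_ iS']; rewrite !kapD.
by rewrite exprD; ring.
Qed.

End Colorings.

(** * The right side of the theorem as a sum over permutations *)

Section CycleExpansion.
Local Notation Lambda := (symfun {poly int}).
Local Notation e := (e_ {poly int}).
Local Notation h := (h_ {poly int}).

Lemma omega_rhoE k : (0 < k)%N ->
  qint k *: e k = \sum_(i < k) e i * omega (rho (k - i)).
Proof.
move=> k0; rewrite -omega_h -linearZ /= rhoE // rmorph_sum.
by apply: eq_bigr => i _; rewrite rmorphM /= omega_h.
Qed.

(* With E, H, P the generating functions of e_i, (-1)^i h_i and omega rho_i, this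
   compares the coefficients in (E P) H = P (E H) = P. *)
Lemma omega_rho_sum N : (0 < N)%N ->
  \sum_(j < N) ((-1) ^+ (N - j.+1) * qint j.+1) *: (e j.+1 * h (N - j.+1)) = omega (rho N).
Proof.
move=> N0; pose E : {poly Lambda} := \poly_(i < N.+1) e i.
pose H : {poly Lambda} := \poly_(i < N.+1) ((-1) ^+ i *: h i).
(* The constant term is set to 0 because [rho 0] is junk; this agrees with the value 0 of the
   q-integer of 0. *)
pose P : {poly Lambda} := \poly_(i < N.+1) (if i == 0%N then 0 else omega (rho i)).
have EP j : (j <= N)%N -> (E * P)`_j = qint j *: e j.
  move=> jN; rewrite coefM; case: j jN => [|j] jN.
    by rewrite big_ord1 !coef_poly /= mulr0 /qint big_ord0 scale0r.
  rewrite big_ord_recr /= subnn !coef_poly /= mulr0 addr0 omega_rhoE //.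
  apply: eq_bigr => i _; rewrite !coef_poly !ltnS (leq_trans (leq_subr _ _) jN).
  by rewrite (leq_trans (ltnW (ltn_ord i)) jN) subn_eq0 leqNgt ltn_ord.
have EH j : (j <= N)%N -> (E * H)`_j = (j == 0%N)%:R.
  move=> jN; rewrite coefM; case: j jN => [|j] jN.
    by rewrite big_ord1 !coef_poly /= e_0 h_0 expr0 scale1r mulr1.
  have := congr1 (fun f : Lambda => (-1 : {poly int}) ^+ j.+1 *: f) (sum_e_h (ltn0Sn j)).
  rewrite scaler0 scaler_sumr => E0; apply: etrans E0; apply: eq_bigr => i _.
  have ij : (i <= j.+1)%N by rewrite -ltnS.
  rewrite !coef_poly !ltnS (leq_trans (leq_subr _ _) jN) (leq_trans ij jN).
  rewrite -scalerAr scalerA -exprD -signr_odd -[in RHS]signr_odd; congr (_ ^+ (nat_of_bool _) *: _).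
  by rewrite oddB // oddD.
have : (E * P * H)`_N = (P * (E * H))`_N by rewrite mulrAC mulrC.
rewrite coefM big_ord_recl EP // /qint big_ord0 scale0r mul0r add0r => PE.
transitivity ((P * (E * H))`_N); last first.
  rewrite coefM big_ord_recr /= subnn EH // mulr1 big1 ?add0r.
    by rewrite coef_poly ltnSn eqn0Ngt N0.
  by move=> i _; rewrite EH ?leq_subr // subn_eq0 leqNgt ltn_ord mulr0.
rewrite -PE; apply: eq_bigr => j _; rewrite /= /bump add1n EP // coef_poly ltnS leq_subr.
by rewrite -scalerAr -scalerAl scalerA.
Qed.

Variables (n : nat) (m : 'I_n -> 'I_n).

Lemma size_cycles_head (sigma : {perm 'I_n}) : (0 < n)%N ->
  (0 < size (head [::] (cycles sigma)) <= n)%N.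
Proof.
move=> n0; have := size_cycles_flatten sigma.
have : {in cycles sigma, forall tau, (0 < size tau)%N}.
  by move=> tau /mapP[i _ ->]; rewrite size_orbit fingraph.order_gt0.
case: (cycles sigma) => [_ n0'|tau c /(_ tau (mem_head _ _)) ->]; first by rewrite -n0' in n0.
by rewrite [flatten _]/= size_cat => sn; rewrite /= -[leqRHS]sn leq_addr.
Qed.

(** With j + 1 = n - k and the sums exchanged, a permutation receives the indices j < |tau_1|, and
    their sum is [omega_rho_sum] for its first cycle. *)
Lemma sum_e_g : (0 < n)%N ->
  \sum_(k < n) qint (n - k) *: (e (n - k) * g_ m k) =
  \sum_(sigma : {perm 'I_n} | [forall i, (sigma i <= m i)%N])
    'X^(wt m sigma) *: \prod_(tau <- cycles sigma) omega (rho (size tau)).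
Proof.
move=> n0; rewrite (reindex_inj rev_ord_inj) /=.
under eq_bigr => j _.
  rewrite subKn; last by rewrite ltn_ord.
  rewrite /g_ subKn; last by rewrite ltn_ord.
  rewrite mulr_sumr scaler_sumr big_mkcondr /=.
  over.
rewrite exchange_big /=; apply: eq_bigr => sigma _; rewrite -big_mkcond.
have /andP[s0 sn] := size_cycles_head sigma n0.
move: s0 sn; case: (cycles sigma) => // tau c /= s0 sn.
rewrite -(big_ord_widen _ (fun j => qint j.+1 *: (e j.+1 *
  ((-1) ^+ (size tau - j.+1) * 'X^(wt m sigma) *: (h (size tau - j.+1) *
     omega (\prod_(tau0 <- c) rho (size tau0))))))) //.
rewrite big_cons -omega_rho_sum // mulr_suml scaler_sumr; apply: eq_bigr => j _.
rewrite rmorph_prod /= -scalerAr !scalerA mulrA -scalerAl scalerA; congr (_ *: _).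
  by ring.
by rewrite mulrA.
Qed.

End CycleExpansion.

(** * Truncation of the weights to finitely many variables *)

Section Truncate.
Import mpoly.
Local Notation Z_q := {poly int}.

Definition q_mp N : {mpoly Z_q[N]} := ('X : Z_q)%:MP.
Definition x_mp N i : {mpoly Z_q[N.+1]} := 'X_(inord i).

Lemma elem_mesym N j : elem (xseq (x_mp N) N.+1) j = mesym N.+1 Z_q j.
Proof.
rewrite /elem /xseq big_map (perm_big (iota 0 N.+1)) ?perm_rev //.
rewrite -[iota 0 N.+1]/(index_iota 0 N.+1) big_mkord.
under eq_bigr => i _ do rewrite addrC.
rewrite bigA_distr coef_sum /mesym [RHS]big_mkcond /=; apply: eq_bigr => J _.
rewrite -big_mkcond /= big_split /= prodr_const -rmorph_prod /= coefCM coefXn eq_sym.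
case: eqP => _; rewrite ?mulr0 // mulr1; apply: eq_bigr => i _.
by rewrite /x_mp inord_val.
Qed.

(** Both sides satisfy the recurrence of [elem_rho_weight], which determines each term from the
    previous ones since e_0 = 1. *)
Lemma trunc_omega_rho N k :
  trunc N.+1 (omega (rho k.+1)) = rho_weight (q_mp N.+1) (xseq (x_mp N) N.+1) k.
Proof.
elim/ltn_ind: k => k IHk.
have := congr1 (trunc N.+1) (omega_rhoE (ltn0Sn k)).
rewrite linearZ /= rmorph_sum trunc_e -elem_mesym -mul_mpolyC rmorph_sum /=.
under eq_bigr => i _ do rewrite rmorphXn.
rewrite elem_rho_weight !big_ord_recl rmorphM /= elem0 e_0 rmorph1 !mul1r !subn0 subn1 /= => E.
apply/esym/(addIr _ (etrans E _)); congr (_ + _); apply: eq_bigr => i _.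
rewrite rmorphM /= trunc_e -elem_mesym /bump add1n subSS; congr (_ * _).
by rewrite -(subnSK (ltn_ord i)) IHk // subnSK // leq_subr.
Qed.

End Truncate.

(** * Colorings with bounded colors inside those by natural numbers *)

Section NatColorings.
Import mpoly.
Variables (n : nat) (m : 'I_n -> 'I_n) (N : nat).
Implicit Types kappa : {ffun 'I_n -> 'I_N.+1}.

Definition nat_coloring kappa : {ffun 'I_n -> nat} := [ffun i => val (kappa i)].

Lemma nat_coloring_inj : injective nat_coloring.
Proof.
move=> kappa kappa' E; apply/ffunP => i; apply/val_inj.
by have := congr1 (fun f : {ffun _} => f i) E; rewrite !ffunE.
Qed.

Lemma proper_nat_coloring kappa :
  proper_coloring m (nat_coloring kappa) <-> coloring_of m N.+1 setT kappa.
Proof.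
split=> [kp|/andP[_ /forall_inP kp] i j].
  apply/andP; split; first by apply/forallP => i; rewrite inE ltn_ord.
  apply/forall_inP => i _; apply/forall_inP => j _; apply/implyP => ij.
  apply/eqP => kij; apply: (kp i j); first by rewrite /hess_graph -/(adj m i j) ij.
  by rewrite !ffunE kij.
have {}kp a b : adj m a b -> kappa a != kappa b.
  by move=> ab; have /forall_inP/(_ b (in_setT _)) := kp a (in_setT _); rewrite ab.
rewrite !ffunE => /orP[/kp/eqP kij /val_inj //|/kp/eqP kji /val_inj/esym //].
Qed.

Lemma asc_nat_coloring kappa : asc m (nat_coloring kappa) = asc_of m setT kappa.
Proof.
rewrite /asc -sum1_card big_mkcond /asc_of exchange_big pair_big /=.
rewrite [RHS]big_mkcond; apply: eq_bigr => -[i j] _; rewrite !inE /= !ffunE.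
by rewrite -/(adj m i j); case: (_ && _).
Qed.

Lemma mon_ext1 (j : 'I_N.+1) : mon_ext U_(j)%MM = monalg.ucm (val j).
Proof.
apply: (@monP N.+1) => [i|i Ni]; first by rewrite mon_extE mnm1E monalg.cmU.
by rewrite mon_extO // monalg.cmU; case: eqP Ni => // <-; rewrite leqNgt ltn_ord.
Qed.

Lemma color_mon_nat_coloring kappa :
  color_mon (nat_coloring kappa) = mon_ext (\sum_(i < n) U_(kappa i))%MM.
Proof.
rewrite /color_mon; apply/esym.
elim/big_rec2: _ => [|i u v _ <-]; first by apply: (@monP N.+1) => [i|i Ni];
  rewrite ?mon_extE ?mon_extO // ?mnm0E monalg.cm1.
by rewrite mon_extD mon_ext1 ffunE.
Qed.

End NatColorings.

(** * Coefficients of csf as finite sums *)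

Section CsfCoefficient.
Import finmap boolp classical_sets functions cardinality fsbigop monalg mpoly.
Variables (n : nat) (m : 'I_n -> 'I_n) (N : nat) (u : mon).
Hypothesis u_supp : forall i, (N < i)%N -> u i = 0%N.

(** A coloring with monomial u uses only variables of u, hence only colors up to N. *)
Lemma csf_sum : csf m u = \sum_(kappa | coloring_of m N.+1 [set: 'I_n]%SET kappa &&
  ((\sum_(i < n) U_(kappa i))%MM == mon_restr N.+1 u)) 'X^(asc_of m [set: 'I_n]%SET kappa).
Proof.
have uE : mon_ext (mon_restr N.+1 u) = u by apply: mon_restrK.
have ext_inj : injective (@mon_ext N.+1) := can_inj (@mon_extK N.+1).
have cuE kappa : (color_mon (nat_coloring kappa) == u) =
    ((\sum_(i < n) U_(kappa i))%MM == mon_restr N.+1 u).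
  by rewrite color_mon_nat_coloring -{1}uE (inj_eq ext_inj).
pose D : set {ffun 'I_n -> nat} := [set kappa | proper_coloring m kappa /\ color_mon kappa = u]%classic.
have finD : finite_set D.
  by apply: (sub_finite_set _ (@finite_color_mon n u)) => kappa [].
rewrite /csf /= fsbig_finite //= -/D.
rewrite -[RHS]big_filter.
under [RHS]eq_bigr => kappa _ do rewrite -asc_nat_coloring.
rewrite -[RHS](big_map (@nat_coloring n N) xpredT (fun k => 'X^(asc m k))).
apply: perm_big; apply: uniq_perm; first exact: fset_uniq.
  by rewrite (map_inj_uniq (@nat_coloring_inj n N)) filter_uniq ?index_enum_uniq.
move=> k; rewrite in_fset_set //; apply/idP/mapP => [|[kappa]].
  rewrite inE => -[kp ku].
  have kN i : (k i < N.+1)%N.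
    rewrite ltnS leqNgt; apply/negP => /u_supp; rewrite -ku /color_mon (bigD1 i) //=.
    by rewrite cmM cmUU.
  have kE : k = nat_coloring [ffun i => Ordinal (kN i)].
    by apply/ffunP => i; rewrite !ffunE.
  exists [ffun i => Ordinal (kN i)] => //; rewrite mem_filter mem_index_enum andbT -cuE -kE.
  by rewrite ku eqxx andbT; apply/proper_nat_coloring; rewrite -kE.
rewrite mem_filter -cuE => /andP[/andP[kp /eqP ku] _] ->; rewrite inE; split=> //.
exact/proper_nat_coloring.
Qed.

End CsfCoefficient.

(** * Comparison of both sides after truncation *)

Section CsfTruncation.
Import finmap monalg mpoly.

Lemma csf_all_color (n : nat) (m : 'I_n -> 'I_n) (N : nat) (u : mon) :
  (forall i, (N < i)%N -> u i = 0%N) -> csf m u =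
  mpoly.mcoeff (mon_restr N.+1 u) (all_color m (q_mp N.+1) (xseq (x_mp N) N.+1) setT).
Proof.
move=> uN; rewrite (csf_sum _ uN) (@all_color_coloring _ n m _ N) // raddf_sum big_mkcondr /=; apply: eq_bigr => kappa _.
rewrite -rmorphXn /= mul_mpolyC mcoeffZ.
have -> : \prod_(i in [set: 'I_n]) x_mp N (kappa i) = 'X_[(\sum_(i < n) U_(kappa i))%MM].
  rewrite (eq_bigl xpredT) => [|i]; last by rewrite finset.in_setT.
  rewrite -(big_map (fun i => U_(kappa i)%MM) xpredT id) -mpolyX_prod big_map.
  by apply: eq_bigr => i _; rewrite /x_mp inord_val.
rewrite mcoeffX.
by case: eqP; rewrite ?mulr1 ?mulr0.
Qed.

Lemma all_color_trunc (n : nat) (m : 'I_n -> 'I_n) (N : nat) : hessenberg m ->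
  all_color m (q_mp N.+1) (xseq (x_mp N) N.+1) [set: 'I_n] =
  trunc N.+1 (\sum_(sigma : {perm 'I_n} | [forall i, (sigma i <= m i)%N])
    'X^(wt m sigma) *: \prod_(tau <- cycles sigma) omega (rho (size tau))).
Proof.
move=> [m_mono m_ge]; rewrite (all_color_cycle_lists (m := m)) // -(sum_cycles m_ge).
rewrite rmorph_sum; apply: eq_bigr => sigma _.
rewrite /= linearZ /= rmorph_prod -mul_mpolyC rmorphXn /= -wt_invw; congr (_ * _).
apply: eq_big_seq => tau /mapP[i _ ->]; rewrite -trunc_omega_rho prednK //.
by rewrite fingraph.size_orbit fingraph.order_gt0.
Qed.

End CsfTruncation.

Theorem theorem1p7 (n : nat) (m : 'I_n -> 'I_n) :
  (0 < n)%N -> hessenberg m ->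
  csf m =
    \sum_(k < n) qint (n - k) *: (e_ {poly int} (n - k) * g_ m k)
    :> series {poly int}.
Proof.
move=> n0 mh; apply/seriesP => u.
(* The largest index of a variable in u, or 0 if u = 1; truncation to the variables 0, ..., N keeps
   the coefficient of u. *)
pose N := (\max_(i <- finmap.enum_fset (finmap.finsupp (monalg.cmonom_val u))) i)%N.
have uN i : (N < i)%N -> finmap.fun_of_fsfun (monalg.cmonom_val u) i = 0%N.
  move=> Ni; apply/eqP; rewrite monalg.cmE_eq0; apply: contraTN Ni => iu.
  by rewrite -leqNgt /N (big_rem i) //= leq_maxl.
rewrite sum_e_g // -{2}(@mon_restrK N.+1 u) // -truncE (csf_all_color m uN).
by rewrite all_color_trunc.
Qed.
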